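(* Let $m,n$ be positive integers with $n\le m$, let $r$ be a nonnegative integer, $X=(x_1,\dots,x_n)$, $Y=(y_1,\dots,y_m)$, and $z$ an indeterminate. Then \[ \sum_{\lambda} z^r\,\mathrm{spo}_\lambda(X;z)\,\mathrm{spo}_{(r^{m-n})\cup\lambda}(Y;z)=\sum_{j=1}^{m+n+1} z^{\,r+m+n+1-j}\,\mathrm{sp}_{(r^{j-1},(r-1)^{m+n+1-j})}(X,Y), \] where $\lambda$ runs over partitions of length at most $n$ with $\lambda_1\le r$, $(r^{m-n})\cup\lambda$ denotes $(r,\dots,r,\lambda_1,\dots,\lambda_n)$ with $m-n$ copies of $r$, and $(r^{j-1},(r-1)^{m+n+1-j})$ denotes the sequence consisting of $j-1$ entries $r$ followed by $m+n+1-j$ entries $r-1$.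
   Context: $\bar x=1/x$. In $\mathrm{spo}_\lambda(X;z)$ the second argument is the single variable $z$ (i.e. $m=1$ there). Orthosymplectic Schur function $\mathrm{spo}_\lambda(x_1,\dots,x_N;y_1,\dots,y_M)$: order $1<\bar1<\cdots<N<\bar N<1'<\cdots<M'$; an orthosymplectic tableau of shape $\lambda$ is a filling of the Young diagram such that the entries from $\{1,\bar1,\dots,N,\bar N\}$ form a symplectic tableau (weakly increasing along rows, strictly increasing down columns, entries in row $i$ are $\ge i$) and the remaining primed entries form a skew filling strictly increasing along rows and weakly increasing down columns; weight $\prod_i x_i^{\#i-\#\bar i}\prod_j y_j^{\#j'}$; $\mathrm{spo}_\lambda$ is the sum of weights. For variables $w_1,\dots,w_N$ and a weakly decreasing integer sequence $\mu=(\mu_1,\dots,\mu_N)$, the symplectic character is $\mathrm{sp}_\mu(w)=\det\left(w_i^{\mu_j+N-j+1}-\bar w_i^{\mu_j+N-j+1}\right)_{i,j}/\det\left(w_i^{N-j+1}-\bar w_i^{N-j+1}\right)_{i,j}$ (for partitions this equals the usual symplectic tableau generating function); $\mathrm{sp}(X,Y)$ means the $N=m+n$ variables $x_1,\dots,x_n,y_1,\dots,y_m$. *)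

(* Defs.v *)
From HB Require Import structures.
From mathcomp Require Import all_boot all_order all_algebra.
Set Implicit Arguments. Unset Strict Implicit. Unset Printing Implicit Defensive.
Import Order.TTheory GRing.Theory Num.Theory.
Local Open Scope ring_scope.

(* Letters of the orthosymplectic alphabet 1 < 1bar < ... < N < Nbar < 1' < ... < M'
   are encoded by a : 'I_(2N+M):  letter k (1-based) = 2(k-1), kbar = 2(k-1)+1,
   primed j' (1-based) = 2N + (j-1).  The order on letters is the order on codes. *)

Section OSP.
Variables (F : fieldType) (N M : nat) (lam : seq nat).

Definition ncols := foldr maxn 0%N lam.
Definition cell := ('I_(size lam) * 'I_ncols)%type.
Definition in_diag (c : cell) : bool := (c.2 < nth 0%N lam c.1)%N.

(* a filling of the Young diagram of lam: Some letter on cells, None off the diagram *)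
Definition filling := {ffun cell -> option 'I_(2 * N + M)}.

Definition ent (T : filling) (c : cell) : nat := if T c is Some a then val a else 0%N.
Definition unpr (T : filling) (c : cell) : bool :=
  if T c is Some a then (val a < 2 * N)%N else false.
Definition prim (T : filling) (c : cell) : bool :=
  if T c is Some a then (2 * N <= val a)%N else false.

Definition is_osp_tableau (T : filling) : bool :=
  [&& [forall c : cell, (T c != None) == in_diag c],
      [forall c1 : cell, forall c2 : cell,
         [&& unpr T c2, (c1.1 <= c2.1)%N & (c1.2 <= c2.2)%N] ==> unpr T c1],
      [forall c1 : cell, forall c2 : cell,
         [&& unpr T c1, unpr T c2, c1.1 == c2.1 & (c1.2 < c2.2)%N]
           ==> (ent T c1 <= ent T c2)%N],
      [forall c1 : cell, forall c2 : cell,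
         [&& unpr T c1, unpr T c2, c1.2 == c2.2 & (c1.1 < c2.1)%N]
           ==> (ent T c1 < ent T c2)%N],
      (* entries in row i (1-based) are >= i *)
      [forall c : cell, unpr T c ==> (2 * c.1 <= ent T c)%N],
      [forall c1 : cell, forall c2 : cell,
         [&& prim T c1, prim T c2, c1.1 == c2.1 & (c1.2 < c2.2)%N]
           ==> (ent T c1 < ent T c2)%N] &
      [forall c1 : cell, forall c2 : cell,
         [&& prim T c1, prim T c2, c1.2 == c2.2 & (c1.1 < c2.1)%N]
           ==> (ent T c1 <= ent T c2)%N]].

Variables (x y : nat -> F).  (* x i = x_{i+1}, y j = y_{j+1} (0-based) *)

Definition letter_weight (a : nat) : F :=
  if (a < 2 * N)%N then (if odd a then (x a./2)^-1 else x a./2)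
  else y (a - 2 * N)%N.

Definition osp_weight (T : filling) : F :=
  \prod_(c | T c != None) letter_weight (ent T c).

Definition spo : F := \sum_(T : filling | is_osp_tableau T) osp_weight T.

End OSP.

(* symplectic character sp_mu(w_1..w_N) via the determinantal (Weyl) formula,
   for a weakly decreasing integer sequence mu of length N *)
Definition sp_num (F : fieldType) (N : nat) (mu : seq int) (w : nat -> F) : F :=
  \det (\matrix_(i < N, j < N)
          (w i ^ (nth 0 mu j + (N - j)%:Z) - (w i)^-1 ^ (nth 0 mu j + (N - j)%:Z))).

Definition sp_den (F : fieldType) (N : nat) (w : nat -> F) : F :=
  \det (\matrix_(i < N, j < N) (w i ^+ (N - j) - (w i)^-1 ^+ (N - j))).

Definition sp (F : fieldType) (N : nat) (mu : seq int) (w : nat -> F) : F :=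
  sp_num N mu w / sp_den N w.

Definition catvars (F : Type) (n : nat) (x y : nat -> F) : nat -> F :=
  fun i => if (i < n)%N then x i else y (i - n)%N.

Definition is_bounded_part (n r : nat) (f : {ffun 'I_n -> 'I_r.+1}) : bool :=
  [forall i : 'I_n, forall j : 'I_n, (i <= j)%N ==> (f j <= f i)%N].

Definition part_seq (n r : nat) (f : {ffun 'I_n -> 'I_r.+1}) : seq nat :=
  [seq val (f i) | i <- enum 'I_n].

(* Main.v *)
Require Import Defs.
From HB Require Import structures.
From mathcomp Require Import all_boot all_order all_algebra all_fingroup.
From mathcomp Require Import zify ring.
Set Implicit Arguments. Unset Strict Implicit. Unset Printing Implicit Defensive.
Import Order.TTheory GRing.Theory Num.Theory.
Local Open Scope ring_scope.

(* In the variable t = w + 1/w, the functions w^a - w^-a become w - 1/w times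
   the Chebyshev polynomials U_a(t), with U_0 = 0 and U_1 = 1, and
   spo_lambda(X; z) becomes a quotient of the determinant of the
   p_(lambda_j + n - j)(t(x_i)), where p_a = U_(a+1) + z U_a, by that of the
   U_(n-j+1)(t(x_i)).  This is obtained by removing the letters of a tableau
   one at a time: each removal is a sum over a product of intervals, hence acts
   columnwise on the determinant, and two consecutive removals telescope.
   The sum over lambda of products of determinants is then a Cauchy-Binet
   expansion of an m x m determinant.  The p_a satisfy a three-term recurrence,
   so that multiplication by Q(t) = prod_j (t - t(y_j)) has a symmetric matrix
   in their basis; reducing the bialternant of (X, Y) modulo Q and using this
   symmetry identifies it with prod_i Q(t(x_i)) times that m x m determinant.
   The right-hand side is the expansion of the same bialternant in powers of z. *)

(** * Determinants of matrices indexed by natural numbers *)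

Section Dt.
Variable F : fieldType.
Implicit Types (f g : nat -> nat -> F).

(** Indices are natural numbers and the size is a parameter, so sizes such as [n + m] and [m + n]
    are exchanged without casts. *)
Definition dt n f : F := \det (\matrix_(i < n, j < n) f i j).

Lemma sum_delta L a (g : nat -> F) : (a < L)%N ->
  \sum_(l < L) (l == a :> nat)%:R * g l = g a.
Proof.
move=> aL; rewrite (bigD1 (Ordinal aL)) //= eqxx mul1r big1 ?addr0 // => i.
by rewrite -val_eqE /= => /negbTE ->; rewrite mul0r.
Qed.

Lemma sum_delta_r L a (g : nat -> F) : (a < L)%N ->
  \sum_(l < L) g l * (l == a :> nat)%:R = g a.
Proof. by move=> aL; rewrite -[RHS](sum_delta _ aL); apply: eq_bigr => l _; rewrite mulrC. Qed.

Lemma dt_ext n f g :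
  (forall i j, (i < n)%N -> (j < n)%N -> f i j = g i j) -> dt n f = dt n g.
Proof. by move=> e; congr (\det _); apply/matrixP => i j; rewrite !mxE e. Qed.

Lemma dt_tr n f : dt n (fun i j => f j i) = dt n f.
Proof. by rewrite /dt -det_tr; congr (\det _); apply/matrixP => i j; rewrite !mxE. Qed.

Lemma dt_mul n f g :
  dt n (fun i j => \sum_(l < n) f i l * g l j) = dt n f * dt n g.
Proof.
rewrite /dt -det_mulmx; congr (\det _); apply/matrixP => i j; rewrite !mxE.
by apply: eq_bigr => l _; rewrite !mxE.
Qed.

Lemma dt_ublock p q f :
  (forall i j, (i < q)%N -> (j < p)%N -> f (p + i)%N j = 0) ->
  dt (p + q) f = dt p f * dt q (fun i j => f (p + i)%N (p + j)%N).
Proof.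
move=> z0; rewrite /dt -[X in \det X = _]submxK.
have -> : dlsubmx (\matrix_(i < p + q, j < p + q) f i j) = 0.
  by apply/matrixP => i j; rewrite !mxE /= z0.
by rewrite det_ublock; congr (_ * _); congr (\det _); apply/matrixP => i j; rewrite !mxE.
Qed.

Lemma dt_lblock p q f :
  (forall i j, (i < p)%N -> (j < q)%N -> f i (p + j)%N = 0) ->
  dt (p + q) f = dt p f * dt q (fun i j => f (p + i)%N (p + j)%N).
Proof.
move=> z0; rewrite -dt_tr dt_ublock => [|i j iq jp]; last exact: z0.
by rewrite dt_tr (dt_tr _ (fun i j => f (p + i)%N (p + j)%N)).
Qed.

Lemma dt_trig1 n f :
  (forall i j, (i < j < n)%N -> f i j = 0) -> (forall i, (i < n)%N -> f i i = 1) ->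
  dt n f = 1.
Proof.
move=> z0 d1; rewrite /dt det_trig.
  by rewrite big1 // => i _; rewrite mxE d1.
by apply/is_trig_mxP => i j ij; rewrite mxE z0 // ij ltn_ord.
Qed.

Lemma dt_trig1T n f :
  (forall i j, (j < i < n)%N -> f i j = 0) -> (forall i, (i < n)%N -> f i i = 1) ->
  dt n f = 1.
Proof. by move=> z0 d1; rewrite -dt_tr; apply: dt_trig1 => // i j; apply: z0. Qed.

Lemma dt_id n : dt n (fun i j => (i == j)%:R) = 1.
Proof. by apply: dt_trig1 => [i j /andP[ij _]|i _]; rewrite ?eqxx // (ltn_eqF ij). Qed.

Lemma dt_scaler n (a : nat -> F) f :
  dt n (fun i j => a i * f i j) = (\prod_(i < n) a i) * dt n f.
Proof.
rewrite /dt /determinant big_distrr /=; apply: eq_bigr => s _.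
rewrite mulrCA -big_split; congr (_ * _); apply: eq_bigr => i _; by rewrite !mxE.
Qed.

Lemma dt_scalec n (a : nat -> F) f :
  dt n (fun i j => a j * f i j) = (\prod_(i < n) a i) * dt n f.
Proof. by rewrite -dt_tr dt_scaler dt_tr. Qed.

Lemma dt_col_eq0 n f a b :
  (a < b < n)%N -> (forall i, (i < n)%N -> f i a = f i b) -> dt n f = 0.
Proof.
move=> /andP[ab bn] e; rewrite -dt_tr.
apply: (@determinant_alternate _ _ _ (Ordinal (ltn_trans ab bn)) (Ordinal bn)).
  by rewrite -val_eqE /= (ltn_eqF ab).
by move=> j; rewrite !mxE /= e.
Qed.

(** Multilinearity: column [j] depends on [f] only through [f j], so a sum over a product of sets is
    carried out column by column. *)
Lemma det_family n (T : finType) (I : 'I_n -> pred T) (A : 'I_n -> 'I_n -> T -> F) :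
  \sum_(f : {ffun 'I_n -> T} | f \in family I) \det (\matrix_(i, j) A i j (f j))
  = \det (\matrix_(i, j) \sum_(b | I j b) A i j b).
Proof.
rewrite -[RHS]det_tr [RHS]/determinant.
transitivity (\sum_(f : {ffun 'I_n -> T} | f \in family I)
   \sum_(s : 'S_n) (-1) ^+ s * \prod_i A (s i) i (f i)).
  apply: eq_bigr => f _; rewrite -det_tr /determinant; apply: eq_bigr => s _.
  by congr (_ * _); apply: eq_bigr => i _; rewrite !mxE.
rewrite exchange_big /=; apply: eq_bigr => s _; rewrite -big_distrr /=; congr (_ * _).
transitivity (\prod_i \sum_(b | I i b) A (s i) i b).
  by rewrite bigA_distr_big_dep.
by apply: eq_bigr => i _; rewrite !mxE.
Qed.

End Dt.

(** * The Chebyshev basis and its Jacobi matrix *)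

Section Recurrence.
Variable F : fieldType.

(* The usual U_(a-1)(t/2): the index is shifted by one and t is not halved. *)
Fixpoint cheb (t : F) a : F :=
  if a is a'.+1 then (if a' is b.+1 then t * cheb t a' - cheb t b else 1) else 0.

Lemma chebSS t a : cheb t a.+2 = t * cheb t a.+1 - cheb t a. Proof. by []. Qed.

Variable z : F.
Definition zcheb a t := cheb t a.+1 + z * cheb t a.

(** The parameter [z] enters the recurrence only here: the first diagonal entry of the Jacobi matrix
    is [- z], all others are 0. *)
Lemma zcheb_rec0 t : t * zcheb 0 t = zcheb 1 t - z * zcheb 0 t.
Proof. rewrite /zcheb /=; ring. Qed.
Lemma zcheb_rec t a : t * zcheb a.+1 t = zcheb a.+2 t + zcheb a t.
Proof. rewrite /zcheb !chebSS; ring. Qed.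

(* The two products of an infinite matrix with the (symmetric, tridiagonal)
   matrix of multiplication by t in the basis of the [zcheb]. *)
Definition jacobi_l (f : nat -> nat -> F) k a :=
  f k.+1 a + (if k is k'.+1 then f k' a else - z * f 0 a).
Definition jacobi_r (f : nat -> nat -> F) k a :=
  f k a.+1 + (if a is a'.+1 then f k a' else - z * f k 0).

Variable v : nat -> F.
(* Row k holds the coordinates of prod_(j < m) (t - v j) * zcheb k t in the basis of the [zcheb]. *)
Fixpoint Qcoef m : nat -> nat -> F :=
  if m is m'.+1 then fun k a => jacobi_l (Qcoef m') k a - v m' * Qcoef m' k a
  else fun k a => (k == a)%:R.

Lemma jacobi_lr f k a : jacobi_l (jacobi_r f) k a = jacobi_r (jacobi_l f) k a.
Proof. by rewrite /jacobi_l /jacobi_r; case: k a => [|k] [|a] /=; ring. Qed.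

(** [Qcoef m] is a polynomial in the Jacobi matrix, hence commutes with it. *)
Lemma Qcoef_lr m k a : jacobi_l (Qcoef m) k a = jacobi_r (Qcoef m) k a.
Proof.
elim: m k a => [|m IH] k a.
  rewrite /jacobi_l /jacobi_r; case: k a => [|k] [|a] //=; rewrite ?eqSS ?eqxx ?mulr0 ?addr0 ?add0r //=.
  by rewrite addrC.
have -> : jacobi_l (Qcoef m.+1) k a = jacobi_l (jacobi_r (Qcoef m)) k a - v m * jacobi_l (Qcoef m) k a.
  by rewrite {1}/jacobi_l /=; case: k => [|k]; rewrite ![in LHS]IH [in RHS]/jacobi_l; ring.
have -> : jacobi_r (Qcoef m.+1) k a = jacobi_r (jacobi_l (Qcoef m)) k a - v m * jacobi_r (Qcoef m) k a.
  by rewrite /jacobi_r /=; case: a => [|a]; ring.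
by rewrite jacobi_lr IH.
Qed.

(** A product of commuting symmetric matrices is symmetric. *)
Lemma Qcoef_sym m k a : Qcoef m k a = Qcoef m a k.
Proof.
elim: m k a => [|m IH] k a; first by rewrite /= eq_sym.
rewrite /= [in RHS]Qcoef_lr (IH k a); congr (_ - _).
by rewrite /jacobi_l /jacobi_r IH; case: k => [|k]; rewrite (IH _ a).
Qed.

(** Each factor [t - v j] raises the index by at most one. Together with the next lemma, where
    leading coefficients are 1, this makes the changes of basis below unitriangular. *)
Lemma Qcoef_eq0 m k a : (k + m < a)%N -> Qcoef m k a = 0.
Proof.
elim: m k a => [|m IH] k a /= h; first by rewrite ltn_eqF // -[k]addn0.
by rewrite /jacobi_l; case: k h => [|k] h; rewrite !IH ?mulr0 ?subr0 ?addr0 //; lia.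
Qed.

Lemma Qcoef_eq1 m k : Qcoef m k (k + m) = 1.
Proof.
elim: m k => [|m IH] k /=; first by rewrite addn0 eqxx.
rewrite /jacobi_l -addSnnS IH.
by case: k => [|k]; rewrite !Qcoef_eq0 ?mulr0 ?subr0 ?addr0 //; lia.
Qed.

Lemma Qcoef_sum m k L t : (k + m < L)%N ->
  \sum_(a < L) Qcoef m k a * zcheb a t = (\prod_(j < m) (t - v j)) * zcheb k t.
Proof.
elim: m k => [|m IH] k h.
  rewrite big_ord0 mul1r addn0 in h *.
  rewrite (bigD1 (Ordinal h)) //= eqxx mul1r big1 ?addr0 // => i ik.
  by rewrite (negbTE (_ : k != i)) ?mul0r // eq_sym.
rewrite big_ord_recr /= -mulrA [(t - _) * _]mulrBl.
(* One linearity identity serves both recurrences: for [k = 0] the index [k.-1] is no true neighbour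
   and receives the coefficient 0. *)
have E : forall c1 c2 c3, \sum_(a < L) (c1 * Qcoef m k.+1 a + c2 * Qcoef m k.-1 a + c3 * Qcoef m k a) * zcheb a t
   = c1 * (\sum_(a < L) Qcoef m k.+1 a * zcheb a t) + c2 * (\sum_(a < L) Qcoef m k.-1 a * zcheb a t)
    + c3 * (\sum_(a < L) Qcoef m k a * zcheb a t).
  move=> c1 c2 c3; rewrite !big_distrr /= -!big_split; apply: eq_bigr => a _ /=; ring.
have h1 : (k.+1 + m < L)%N by lia.
have h2 : (k.-1 + m < L)%N by lia.
have h3 : (k + m < L)%N by lia.
case: k h h1 h2 h3 E => [|k] h h1 h2 h3 E.
  have := E 1 0 (- z - v m); rewrite !IH // (zcheb_rec0 t) => Es.
  transitivity (1 * (\prod_(j < m) (t - v j) * zcheb 1 t) + 0 * (\prod_(j < m) (t - v j) * zcheb 0 t) + (- z - v m) * (\prod_(j < m) (t - v j) * zcheb 0 t)).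
    rewrite -Es; apply: eq_bigr => a _; rewrite /jacobi_l /=; ring.
  ring.
have := E 1 1 (- v m); rewrite !IH // (zcheb_rec t) => Es /=.
transitivity (1 * (\prod_(j < m) (t - v j) * zcheb k.+2 t) + 1 * (\prod_(j < m) (t - v j) * zcheb k t) + (- v m) * (\prod_(j < m) (t - v j) * zcheb k.+1 t)).
  rewrite -Es; apply: eq_bigr => a _; rewrite /jacobi_l /=; ring.
ring.
Qed.

End Recurrence.

Arguments cheb : simpl never.

(** * Reduction modulo Q *)

Section Reduction.
Variables (F : fieldType) (z : F) (u v : nat -> F) (n k r : nat).
Local Notation m := (k + n)%N.
Local Notation R := (r + n)%N.
Local Notation p := (zcheb z).
Let Q t := \prod_(j < m) (t - v j).

(** In a Cauchy-Binet expansion the first [k] unit rows force the columns [0, ..., k - 1] to be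
    selected; these stand for the [k] parts equal to [r]. *)
Definition kernel_row i l : F :=
  if (i < k)%N then (i == l)%:R
  else if (l < k)%N then 0 else p (m + r - 1 - l) (u (i - k)).

Lemma sum_rev L (g : nat -> F) : \sum_(l < L) g (L - 1 - l)%N = \sum_(l < L) g l.
Proof.
rewrite [RHS](reindex_inj rev_ord_inj) /=; apply: eq_bigr => i _.
by congr g; rewrite subnS; lia.
Qed.

(** A permutation matrix exchanging blocks of [m] and [r] indices. Its sign is never computed: it is
    a common factor of the two reductions below. *)
Let sw i l : F := (l == if i < m then i + r else i - m)%N%:R.
Let A i j := if (i < n)%N then p (R - 1 - j) (u i) else Qcoef z v m (R - 1 - j) (r - 1 - (i - n)).

(** The bialternant in all variables, bordered by [r] unit rows to make room for the change of basis
    [W]. *)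
Let X i j : F := if (i < n + m)%N then p (r + n + m - 1 - j) (catvars n u v i) else (i == j)%:R.
(* The change of basis from the p_a to the Q p_a (a < r + n) followed by the p_a (a < m). *)
Let W i j : F := if (j < R)%N then Qcoef z v m (R - 1 - j) (R + m - 1 - i) else (i == j)%:R.
Let Sw i l : F := if (i < n)%N then (i == l)%:R
  else (l == n + (if i - n < m then i - n + r else i - n - m))%N%:R.
(** The product of [X] and [W] with its last two blocks of rows exchanged. The rows of [v] vanish in
    the first [r + n] columns, since Q vanishes at each [v j]. *)
Let Y i j : F :=
  if (i < n)%N then (if (j < R)%N then Q (u i) * p (R - 1 - j) (u i) else p (R + m - 1 - j) (u i))
  else if (i < R)%N then
    (if (j < R)%N then Qcoef z v m (R - 1 - j) (r - 1 - (i - n)) else (m + i == j)%N%:R)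
  else if (j < R)%N then 0 else p (R + m - 1 - j) (v (i - R)%N).

Let sumXW i j : (i < n + m + r)%N -> (j < n + m + r)%N ->
  \sum_(l < n + m + r) X i l * W l j =
  if (i < n + m)%N then
    (if (j < R)%N then Q (catvars n u v i) * p (R - 1 - j) (catvars n u v i)
     else p (R + m - 1 - j) (catvars n u v i))
  else W i j.
Proof.
move=> iN jN; case: ifP => [iN'|iN'].
  case: ifP => jR; last first.
    rewrite (eq_bigr (fun l : 'I__ => X i l * ((l : nat) == j)%:R)).
      by rewrite sum_delta_r // /X iN'; congr p; lia.
    by move=> l _; rewrite /W jR.
  rewrite -(@Qcoef_sum _ z v m _ (n + m + r)); last lia.
  rewrite -[RHS](sum_rev _ (fun a => Qcoef z v m (R - 1 - j) a * p a (catvars n u v i))); apply: eq_bigr => l _; rewrite /X iN' /W jR mulrC.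
  congr (Qcoef z v m _ _ * p _ _); lia.
rewrite -[RHS](sum_delta (fun l => W l j) iN).
by apply: eq_bigr => l _; rewrite /X iN' eq_sym.
Qed.

(** After the unitriangular change of basis the first [r + n] columns are multiples of Q at the
    points [u] and [v]. They vanish at [v], which leaves a block triangular matrix, and the factors
    Q(u_i) come out of the rows of [u]. *)
Lemma dt_cat_reduce :
  dt (n + m) (fun i j => p (r + n + m - 1 - j) (catvars n u v i)) =
  dt (m + r) sw * ((\prod_(i < n) Q (u i)) * dt R A * dt m (fun i j => p (m - 1 - j) (v i))).
Proof.
transitivity (dt (n + m + r) X).
  rewrite [RHS]dt_ublock => [|i j ir jN]; last by rewrite /X ifF ?(gtn_eqF _) //; lia.
  rewrite [X in _ * X](_ : _ = 1); last first.
    rewrite -[RHS](dt_id F r); apply: dt_ext => i j ir jr.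
    by rewrite /X ifF ?eqn_add2l //; lia.
  by rewrite mulr1; apply: dt_ext => i j iN jN; rewrite /X iN.
have dW : dt (n + m + r) W = 1.
  apply: dt_trig1 => [i j /andP[ij jN]|i iN]; rewrite /W.
    by case: ifP => jR; [rewrite Qcoef_eq0 //; lia | rewrite ltn_eqF].
  case: ifP => jR; last by rewrite eqxx.
  by rewrite (_ : (R + m - 1 - i = R - 1 - i + m)%N) ?Qcoef_eq1 //; lia.
rewrite -[LHS]mulr1 -[X in _ * X = _]dW -dt_mul.
have dSw : dt (n + (m + r)) Sw = dt (m + r) sw.
  rewrite dt_ublock => [|i j ir jn]; last first.
    by rewrite /Sw ifF ?(ltn_eqF _) //; lia.
  rewrite [X in X * _](_ : _ = 1) ?mul1r.
    apply: dt_ext => i j ir jr; rewrite /Sw /sw ifF; last lia.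
    by rewrite eqn_add2l addKn.
  by rewrite -[RHS](dt_id F n); apply: dt_ext => i j ir jr; rewrite /Sw ir.
have -> : dt (n + m + r) (fun i j => \sum_(l < n + m + r) X i l * W l j)
   = dt (n + (m + r)) Sw * dt (n + (m + r)) Y.
  rewrite -dt_mul (addnA n m r); apply: dt_ext => i j iN jN; rewrite sumXW //.
  pose a := if (i < n)%N then i else (n + (if (i - n < m)%N then i - n + r else i - n - m))%N.
  rewrite (eq_bigr (fun l : 'I__ => ((l : nat) == a)%:R * Y l j)); last first.
    by move=> l _; rewrite /Sw /a; case: ifP => // _; rewrite eq_sym.
  rewrite (sum_delta (fun l => Y l j)); last by rewrite /a; repeat case: ifP => ?; lia.
  rewrite /a /Y /catvars; case: (ltnP i n) => iln.
    by rewrite iln ifT //; lia.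
  case: (ltnP i (n + m)) => iln2.
    have im : (i - n < m)%N by lia.
    rewrite im.
    have -> : (n + (i - n + r) < n)%N = false by lia.
    have -> : (n + (i - n + r) < R)%N = false by lia.
    rewrite /Q; case: ifP => jR.
      by rewrite (bigD1 (Ordinal im)) /= ?subrr ?mul0r.
    by congr (p _ (v _)); lia.
  have -> : (i - n < m)%N = false by lia.
  have -> : (n + (i - n - m) < n)%N = false by lia.
  have -> : (n + (i - n - m) < R)%N by lia.
  rewrite /W; case: ifP => jR; first by congr Qcoef; lia.
  by congr (nat_of_bool _)%:R; congr (_ == _); lia.
rewrite dSw; congr (_ * _).
have -> : (n + (m + r) = R + m)%N by lia.
rewrite dt_ublock => [|i j im jR]; last first.
  by rewrite /Y jR !ifF //; lia.
congr (_ * _); last first.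
  apply: dt_ext => i j im jm; rewrite /Y !ifF; try lia.
  by congr (p _ (v _)); lia.
pose a i := if (i < n)%N then Q (u i) else 1.
have -> : \prod_(i < n) Q (u i) = \prod_(i < R) a i.
  rewrite addnC big_split_ord /= [X in _ * X]big1 ?mulr1 => [|i _]; last first.
    by rewrite /a ifF //; lia.
  by apply: eq_bigr => i _; rewrite /a ltn_ord.
rewrite -dt_scaler; apply: dt_ext => i j iR jR; rewrite /Y /a /A jR iR.
by case: ifP => _; rewrite ?mul1r.
Qed.

(** The kernel completed to a square matrix by [r] rows of [Qcoef], which annihilate the evaluations
    at [v]. *)
Let G i l : F := if (i < m)%N then kernel_row i l else Qcoef z v m (r - 1 - (i - m)) (m + r - 1 - l).
Let DZ l j : F := if (j < m)%N then p (m + r - 1 - l) (v j) else (l == j - m)%N%:R.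
Let ZD l j : F := if (j < r)%N then (l == j)%:R else p (m + r - 1 - l) (v (j - r)%N).

(** In the product of [G] and [DZ] the upper left block is the matrix of the left-hand side, the
    lower left block is zero and the lower right block is unitriangular. The determinants of [G] and
    [DZ] are the factors on the right. *)
Lemma dt_kernel_reduce :
  dt m (fun i j => \sum_(l < m + r) kernel_row i l * p (m + r - 1 - l) (v j)) =
  dt (m + r) sw * (dt R A * dt m (fun i j => p (m - 1 - j) (v i))).
Proof.
have dG : dt (m + r) G = dt R A.
  rewrite -addnA [(n + r)%N]addnC dt_lblock => [|i j ik jR]; last first.
    rewrite /G /kernel_row ik ifT ?ltn_eqF //; lia.
  rewrite [X in X * _](_ : _ = 1) ?mul1r.
    apply: dt_ext => i j iR jR; rewrite /G /A /kernel_row ltn_add2l.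
    case: ifP => h; first by rewrite !ifF ?addKn; [congr p; lia | lia | lia].
    (* Symmetry enters here: [G] contains rows of [Qcoef] where [A] contains columns. *)
    by rewrite [RHS]Qcoef_sym; congr Qcoef; lia.
  rewrite -[RHS](dt_id F k); apply: dt_ext => i j ir jr.
  by rewrite /G /kernel_row ir ifT //; lia.
have dZ : dt (m + r) DZ = dt (m + r) sw * dt m (fun i j => p (m - 1 - j) (v i)).
  rewrite -[dt _ sw]dt_tr mulrC.
  have -> : dt m (fun i j => p (m - 1 - j) (v i)) = dt (m + r) ZD.
    rewrite [(m + r)%N]addnC [RHS]dt_ublock => [|i j im jr]; last first.
      by rewrite /ZD jr gtn_eqF //; lia.
    rewrite [X in X * _](_ : _ = 1) ?mul1r.
      rewrite -[LHS]dt_tr; apply: dt_ext => i j im jm; rewrite /ZD ifF; last lia.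
      by congr (p _ (v _)); lia.
    by rewrite -[RHS](dt_id F r); apply: dt_ext => i j ir jr; rewrite /ZD jr.
  rewrite -dt_mul; apply: dt_ext => l j lN jN; rewrite /sw.
  rewrite (sum_delta_r (fun c => ZD l c)); last by case: ifP; lia.
  rewrite /ZD /DZ; case: ifP => jm.
    by rewrite ifF ?addnK //; lia.
  by rewrite ifT //; lia.
(* The lower left entries are values at [v j] of multiples of Q, hence zero. *)
rewrite mulrCA -dZ -dG -dt_mul [RHS]dt_ublock => [|i j ir jm]; last first.
  rewrite (eq_bigr (fun l : 'I__ => Qcoef z v m (r - 1 - i) (m + r - 1 - l) * p (m + r - 1 - l) (v j))).
    rewrite (sum_rev _ (fun l => Qcoef z v m (r - 1 - i) l * p l (v j))) Qcoef_sum; last lia.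
    by rewrite (bigD1 (Ordinal jm)) //= subrr !mul0r.
  move=> l _; rewrite /G /DZ jm ifF; last lia.
  by congr (Qcoef _ _ _ _ _ * _); lia.
rewrite [X in _ * X](_ : _ = 1) ?mulr1.
  apply: dt_ext => i j im jm; apply: eq_bigr => l _.
  by rewrite /G /DZ im jm.
apply: dt_trig1T => [i j /andP[ji ir]|i ir].
  rewrite (eq_bigr (fun l : 'I__ => G (m + i) l * ((l : nat) == j)%:R)).
    rewrite sum_delta_r; last lia.
    rewrite /G ifF; last lia.
    by rewrite Qcoef_eq0 //; lia.
  by move=> l _; rewrite /DZ ifF ?addKn //; lia.
rewrite (eq_bigr (fun l : 'I__ => G (m + i) l * ((l : nat) == i)%:R)).
  rewrite sum_delta_r; last lia.
  rewrite /G ifF; last lia.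
  by rewrite -[RHS](Qcoef_eq1 z v m (r - 1 - i)); congr Qcoef; lia.
by move=> l _; rewrite /DZ ifF ?addKn //; lia.
Qed.

Lemma dt_cat_kernel :
  dt (n + m) (fun i j => p (r + n + m - 1 - j) (catvars n u v i)) =
  (\prod_(i < n) \prod_(j < m) (u i - v j)) *
  dt m (fun i j => \sum_(l < m + r) kernel_row i l * p (m + r - 1 - l) (v j)).
Proof. by rewrite dt_cat_reduce dt_kernel_reduce -mulrA mulrCA. Qed.

End Reduction.

(** * The Cauchy-Binet expansion *)

Section CauchyBinet.
Variables (R : comNzRingType) (n L : nat).
Implicit Types (f s : {ffun 'I_n -> 'I_L}).

Definition increasing s := [forall i : 'I_n, forall j : 'I_n, (i < j)%N ==> (s i < s j)%N].

Lemma increasingP s : reflect {mono s : i j / (i < j)%N} (increasing s).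
Proof.
apply: (iffP forallP) => [h i j|h i]; last by apply/forallP => j; rewrite h implybb.
have H (a b : 'I_n) : (a < b)%N -> (s a < s b)%N by move=> ab; have /forallP/(_ b)/implyP := h a; apply.
apply/idP/idP; last exact: H.
by case: (ltngtP i j) => // [/H|/val_inj ->]; lia.
Qed.

(** The default [j] of [insubd] is never taken: [j] itself is not counted, so the rank is below
    [n]. *)
Let rk f (j : 'I_n) : 'I_n := insubd j #|[set i | f i < f j]%N|.

Let rkE f j : rk f j = #|[set i | f i < f j]%N| :> nat.
Proof.
rewrite val_insubd ifT // -[X in (_ < X)%N]card_ord -cardsT; apply: proper_card.
by apply/properP; split; [apply: subsetT | exists j; rewrite ?inE ?ltnn].
Qed.

Let rk_lt f i j : (f i < f j)%N -> (rk f i < rk f j)%N.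
Proof.
move=> ij; rewrite !rkE; apply: proper_card; apply/properP; split.
  by apply/subsetP => l; rewrite !inE => /ltn_trans; apply.
by exists i; rewrite !inE ?ltnn.
Qed.

Let rk_inj f : injective f -> injective (rk f).
Proof.
move=> fi i j e; apply: fi; apply: val_inj.
by case: (ltngtP (f i) (f j)) => // /rk_lt; rewrite e ltnn.
Qed.

(** For injective [f] the ranks form a permutation; the default identity only serves the other
    functions. *)
Let rkp f : 'S_n := odflt 1%g [pick t : 'S_n | [forall j, t j == rk f j]].

Let rkpE f j : injective f -> rkp f j = rk f j.
Proof.
move=> /rk_inj fi; rewrite /rkp; case: pickP => [t /forallP /(_ j) /eqP //|/(_ (perm fi))].
by move/negbT/forallPn => [i]; rewrite permE eqxx.
Qed.

Let srt f : {ffun 'I_n -> 'I_L} := [ffun j => f ((rkp f)^-1%g j)].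

Let srt_increasing f : injective f -> increasing (srt f).
Proof.
move=> fi; apply/forallP => i; apply/forallP => j; apply/implyP => ij; rewrite !ffunE.
have e a : a = rk f ((rkp f)^-1%g a) by rewrite -rkpE // permKV.
move: ij; rewrite {1}(e i) {1}(e j).
case: (ltngtP (f _) (f _)) => // [/rk_lt|/val_inj/fi ->]; lia.
Qed.

Let rk_comp s (t : 'S_n) : increasing s -> rkp [ffun j => s (t j)] = t.
Proof.
move=> /increasingP si; have fi : injective [ffun j => s (t j)].
  move=> i j; rewrite !ffunE => e; apply: (@perm_inj _ t); apply: val_inj.
  by case: (ltngtP (t i) (t j)) => // h; move: h; rewrite -si e ltnn.
apply/permP => j; rewrite rkpE //; apply: val_inj; rewrite /= rkE.
rewrite (_ : [set i | _] = t @^-1: [set i : 'I_n | (i < t j)%N]); last first.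
  by apply/setP => i; rewrite !inE !ffunE si.
rewrite card_preimset; last exact: perm_inj.
by rewrite -sum1dep_card -(big_ord_widen _ (fun=> 1%N)) ?sum1_card ?card_ord // ltnW.
Qed.

(** Expanding the columns of the product gives a sum over all functions [f]. Those with a repeated
    value give equal columns; an injective one is uniquely an increasing [s] after a permutation,
    and the sum over permutations rebuilds the minor of [B]. *)
Lemma cauchy_binet (A : 'M[R]_(n, L)) (B : 'M[R]_(L, n)) :
  \det (A *m B) = \sum_(s : {ffun 'I_n -> 'I_L} | increasing s)
     \det (\matrix_(i, j) A i (s j)) * \det (\matrix_(i, j) B (s i) j).
Proof.
transitivity (\sum_(f : {ffun 'I_n -> 'I_L})
   \det (\matrix_(i, j) A i (f j)) * \prod_j B (f j) j).
  rewrite -[LHS]det_tr [LHS]/determinant.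
  under [RHS]eq_bigr => f _ do rewrite -det_tr /determinant big_distrl /=.
  rewrite exchange_big /=; apply: eq_bigr => t _.
  under [RHS]eq_bigr => f _ do rewrite -mulrA.
  rewrite -big_distrr /=; congr (_ * _).
  under eq_bigr => i _ do rewrite !mxE.
  rewrite bigA_distr_bigA /=; apply: eq_bigr => f _; rewrite -big_split /=.
  by apply: eq_bigr => i _; rewrite !mxE.
rewrite (bigID (fun f => injectiveb f)) /= [X in _ + X]big1 ?addr0; last first.
  move=> f /injectivePn [a [b ab e]]; rewrite -det_tr (determinant_alternate ab) ?mul0r //.
  by move=> i; rewrite !mxE e.
rewrite (partition_big srt increasing) => [|f /injectiveP fi]; last exact: srt_increasing.
apply: eq_bigr => s si.
rewrite (reindex_onto (fun t : 'S_n => [ffun j => s (t j)]) rkp) /=; last first.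
  move=> f /andP[/injectiveP fi /eqP <-]; apply/ffunP => j; rewrite !ffunE.
  by rewrite permK.
rewrite -[\det (\matrix_(i, j) B _ j)]det_tr {2}/determinant big_distrr /=.
have stri (t : 'S_n) : increasing s -> injectiveb [ffun j => s (t j)] && (srt [ffun j => s (t j)] == s) && (rkp [ffun j => s (t j)] == t).
  move=> _; rewrite rk_comp // eqxx andbT; apply/andP; split.
    apply/injectiveP => i j; rewrite !ffunE => e; apply: (@perm_inj _ t); apply: val_inj.
    by case: (ltngtP (t i) (t j)) => // h; move: h; rewrite -(increasingP _ si) e ltnn.
  by apply/eqP/ffunP => j; rewrite /srt !ffunE rk_comp // permKV.
rewrite (eq_bigl xpredT) => [|t]; last exact: stri.
apply: eq_bigr => t _.
have -> : \matrix_(i, j) A i ([ffun j0 => s (t j0)] j) = col_perm t (\matrix_(i, j) A i (s j)).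
  by apply/matrixP => i j; rewrite !mxE ffunE.
rewrite col_permE det_mulmx det_perm odd_permV -mulrA; congr (_ * (_ * _)).
by apply: eq_bigr => i _; rewrite !mxE ffunE.
Qed.
End CauchyBinet.

Lemma increasing_gap n L (s : {ffun 'I_n -> 'I_L}) (i j : 'I_n) :
  increasing s -> (i <= j)%N -> (s i + (j - i) <= s j)%N.
Proof.
move=> /increasingP si ij; have [d e] : exists d, j = (i + d)%N :> nat by exists (j - i)%N; lia.
elim: d j e {ij} => [|d IH] j e.
  by rewrite (_ : j = i) ?subnn ?addn0 //; apply: val_inj; rewrite /= e addn0.
have h : (i + d < n)%N by move: (ltn_ord j); lia.
have := IH (Ordinal h) erefl; have : (s (Ordinal h) < s j)%N by rewrite si /= e; lia.
rewrite /= e; lia.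
Qed.

(** * Partitions in a box as increasing column selections *)

Section PartSum.
Variables (F : fieldType) (z : F) (u v : nat -> F) (n k r : nat).
Local Notation m := (k + n)%N.
Local Notation p := (zcheb z).
Implicit Types (f : {ffun 'I_n -> 'I_r.+1}) (s : {ffun 'I_m -> 'I_(m + r)}).

Lemma nth_part_seq f j (jn : (j < n)%N) : nth 0%N (part_seq f) j = f (Ordinal jn).
Proof.
have e := nth_ord_enum (Ordinal jn) (Ordinal jn).
by rewrite (nth_map (Ordinal jn)) ?size_enum_ord // [nth _ _ _]e.
Qed.

Definition rpart f j := nth 0%N (nseq k r ++ part_seq f) j.

Lemma rpart_lt f j : (j < k)%N -> rpart f j = r.
Proof. by move=> jk; rewrite /rpart nth_cat size_nseq jk nth_nseq jk. Qed.

Lemma rpart_ge f j : rpart f (k + j) = nth 0%N (part_seq f) j.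
Proof. by rewrite /rpart nth_cat size_nseq ifF ?addKn //; lia. Qed.

Lemma rpart_le f j : (rpart f j <= r)%N.
Proof.
case: (ltnP j k) => [/(rpart_lt f)->//|kj].
rewrite -(subnKC kj) rpart_ge; case: (ltnP (j - k) n) => h.
  by rewrite (nth_part_seq _ h) -ltnS.
by rewrite nth_default // size_map size_enum_ord.
Qed.

Lemma rpart_dec f i j : is_bounded_part f -> (i <= j)%N -> (rpart f j <= rpart f i)%N.
Proof.
move=> fp ij; case: (ltnP i k) => [/(rpart_lt f)->|ki]; first exact: rpart_le.
have kj := leq_trans ki ij.
rewrite -(subnKC ki) -(subnKC kj) !rpart_ge; case: (ltnP (j - k) n) => h; last first.
  by rewrite nth_default // size_map size_enum_ord.
have h' : (i - k < n)%N by lia.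
rewrite (nth_part_seq _ h) (nth_part_seq _ h').
by move/forallP/(_ (Ordinal h'))/forallP/(_ (Ordinal h))/implyP: fp; apply => /=; lia.
Qed.

(** Column [l] of the kernel carries the index [m + r - 1 - l]; selecting [l = sn f j] yields the
    exponent [rpart f j + (m - 1 - j)] of the bialternant. *)
Let sn f j := (j + (r - rpart f j))%N.

Let sn_lt f (j : 'I_m) : (sn f j < m + r)%N.
Proof. by rewrite /sn; move: (ltn_ord j); lia. Qed.

Let s_of f : {ffun 'I_m -> 'I_(m + r)} := [ffun j => Ordinal (sn_lt f j)].
Let f_of s : {ffun 'I_n -> 'I_r.+1} := [ffun j => inord (r - (s (rshift k j) - (k + j)))].

Let fixed s := [forall i : 'I_m, (i < k)%N ==> (s i == i :> nat)].

Let s_ofK f : f_of (s_of f) = f.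
Proof.
apply/ffunP => j; rewrite !ffunE; apply: val_inj; rewrite /= inordK; last lia.
rewrite /sn rpart_ge (nth_part_seq _ (ltn_ord j)) addKn subKn; last by rewrite -ltnS.
by congr (val (f _)); apply: val_inj.
Qed.

Let s_of_fixed f : fixed (s_of f).
Proof. by apply/forallP => i; apply/implyP => ik; rewrite ffunE /= /sn rpart_lt // subnn addn0. Qed.

Let s_of_increasing f : increasing (s_of f) = is_bounded_part f.
Proof.
apply/idP/idP => [si|fp].
  apply/forallP => i; apply/forallP => j; apply/implyP => ij.
  have := @increasing_gap _ _ _ (rshift k i) (rshift k j) si; rewrite !ffunE /= /sn !rpart_ge.
  have := rpart_le f (k + i); have := rpart_le f (k + j); rewrite !rpart_ge.
  rewrite !(nth_part_seq f (ltn_ord _)).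
  have e (a : 'I_n) h : f (Ordinal (n:=n) (m:=a) h) = f a by congr (f _); apply: val_inj.
  rewrite !e; lia.
apply/forallP => i; apply/forallP => j; apply/implyP => ij; rewrite !ffunE /= /sn.
have := rpart_dec fp (ltnW ij); have := rpart_le f i; lia.
Qed.

Let s_bnd s (j : 'I_m) : increasing s -> (j <= s j <= j + r)%N.
Proof.
move=> si; have m0 : (0 < m)%N by apply: leq_ltn_trans (ltn_ord j).
have m1 : (m.-1 < m)%N by lia.
have := @increasing_gap _ _ _ (Ordinal m0) j si isT.
have := @increasing_gap _ _ _ j (Ordinal m1) si; rewrite /=.
move: (ltn_ord (s (Ordinal m1))) (ltn_ord j); lia.
Qed.

Let f_ofK s : increasing s -> fixed s -> s_of (f_of s) = s.
Proof.
move=> si sf; apply/ffunP => j; rewrite !ffunE; apply: val_inj; rewrite /= /sn.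
case: (ltnP j k) => jk.
  rewrite rpart_lt // subnn addn0.
  by move/forallP/(_ j)/implyP/(_ jk)/eqP: sf.
have jn : (j - k < n)%N by move: (ltn_ord j); lia.
have -> : rpart (f_of s) j = (r - (s j - j))%N.
  rewrite -{1}(subnKC jk) rpart_ge (nth_part_seq _ jn) ffunE inordK; last lia.
  have -> : rshift k (Ordinal jn) = j by apply: val_inj => /=; lia.
  by rewrite /= subnKC.
have := s_bnd j si; lia.
Qed.

(** A selection that moves some index below [k] misses such an index altogether, so the matching
    unit row of the minor is zero. *)
Let fixedN s : increasing s -> ~~ fixed s -> exists2 i : 'I_m, (i < k)%N & forall j, s j != i :> nat.
Proof.
move=> si; case: (boolP [forall i : 'I_m, (i < k)%N ==> [exists j, s j == i :> nat]]); last first.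
  move=> /forallPn[i]; rewrite negb_imply => /andP[ik /existsPn h] _.
  by exists i => // j; apply: h.
move=> /forallP h /forallPn[i]; rewrite negb_imply => /andP[ik /negP[]].
(* Strong induction. If [s j = i] with [j < i], the hypothesis gives [s j = j]; if [j > i],
   monotonicity gives [s i < i]. Both are impossible. *)
have [d] := ubnP (i : nat); elim: d i ik => // d IH i ik id.
move/(_ i)/implyP/(_ ik)/existsP: h => [j /eqP e].
case: (ltngtP j i) => ji.
- have /eqP := IH j (ltn_trans ji ik) (leq_trans ji id); lia.
- by have := s_bnd i si; move: ji; rewrite -(increasingP _ si); lia.
by rewrite -{1}(val_inj ji) e.
Qed.

(** By Cauchy-Binet only selections fixing the first [k] indices contribute, and [sn] puts these in
    bijection with the partitions in the box. *)
Lemma sum_bounded_part :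
  dt m (fun i j => \sum_(l < m + r) kernel_row z u n k r i l * p (m + r - 1 - l) (v j)) =
  \sum_(f : {ffun 'I_n -> 'I_r.+1} | is_bounded_part f)
    dt n (fun i j => p (nth 0%N (part_seq f) j + (n - 1 - j)) (u i)) *
    dt m (fun i j => p (nth 0%N (nseq k r ++ part_seq f) j + (m - 1 - j)) (v i)).
Proof.
pose A : 'M[F]_(m, m + r) := \matrix_(i, l) kernel_row z u n k r i l.
pose B : 'M[F]_(m + r, m) := \matrix_(l, j) p (m + r - 1 - l) (v j).
transitivity (\det (A *m B)).
  congr (\det _); apply/matrixP => i j; rewrite !mxE; apply: eq_bigr => l _; by rewrite !mxE.
rewrite cauchy_binet (bigID fixed) /= [X in _ + X]big1 ?addr0; last first.
  move=> s /andP[si /(fixedN si)[i ik h]].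
  rewrite (expand_det_row _ i) big1 ?mul0r // => j _.
  by rewrite !mxE /kernel_row ik eq_sym (negbTE (h j)) mul0r.
rewrite (reindex_onto s_of f_of) /=; last by move=> s /andP[]; apply: f_ofK.
apply: eq_big => [f|f _]; first by rewrite s_of_increasing s_of_fixed s_ofK eqxx !andbT.
congr (_ * _).
  transitivity (dt m (fun i j => kernel_row z u n k r i (sn f j))).
    by congr (\det _); apply/matrixP => i j; rewrite !mxE ffunE.
  rewrite dt_lblock => [|i j ik jn]; last first.
    by rewrite /kernel_row ik /sn ltn_eqF //; lia.
  rewrite [X in X * _](_ : _ = 1) ?mul1r; last first.
    rewrite -[RHS](dt_id F k); apply: dt_ext => i j ik jk.
    by rewrite /kernel_row ik /sn rpart_lt // subnn addn0.
  apply: dt_ext => i j iL jL; rewrite /kernel_row !ifF ?addKn /sn; try lia.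
  rewrite rpart_ge; congr p; have := rpart_le f (k + j); rewrite rpart_ge; lia.
rewrite /dt -det_tr; congr (\det _); apply/matrixP => i j; rewrite !mxE ffunE /= /sn.
congr p; have := rpart_le f j; rewrite /rpart; move: (ltn_ord j); lia.
Qed.

End PartSum.

(** * Removing the largest letter of a tableau *)

(** Such a set is an initial segment, so the small letters of a tableau row are recorded by their
    number alone. *)
Lemma down_closed_card C (A : {set 'I_C}) (j : 'I_C) :
  (forall a b : 'I_C, (a < b)%N -> b \in A -> a \in A) -> (j \in A) = (j < #|A|)%N.
Proof.
have card_lt k : (k <= C)%N -> #|[set i : 'I_C | (i < k)%N]| = k.
  by move=> kC; rewrite -sum1dep_card -(big_ord_widen _ (fun=> 1%N)) ?sum1_card ?card_ord.
move=> dc; apply/idP/idP => [jA|].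
  rewrite -[X in (X <= _)%N](card_lt _ (ltn_ord j)); apply: subset_leq_card.
  apply/subsetP => i; rewrite inE ltnS leq_eqVlt => /orP[/eqP/val_inj->//|ij].
  exact: dc ij jA.
apply: contraTT => jA; rewrite -leqNgt -[X in (_ <= X)%N](card_lt j (ltnW (ltn_ord j))).
apply: subset_leq_card; apply/subsetP => i iA; rewrite inE ltnNge leq_eqVlt.
by apply: contra jA => /orP[/eqP/val_inj->//|/dc]; apply.
Qed.

Section Tableaux.
Variables (F : fieldType) (lam : seq nat).
Variables (x y : nat -> F).
Local Notation d := (size lam).
Local Notation C := (ncols lam).
Local Notation fill := (filling d 1 lam).
Local Notation shape := {ffun 'I_d -> 'I_C.+1}.
Implicit Types (T : fill) (mu nu : shape) (L : nat) (i : 'I_d) (j : 'I_C).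

(** The smaller letter decides: if unprimed it may repeat along a row, if primed it may repeat down
    a column. Mixed pairs are thereby forced into the right order. *)
Definition row_ok (e e' : nat) : bool := if (e < 2 * d)%N then (e <= e')%N else (e < e')%N.
Definition col_ok (e e' : nat) : bool := if (e < 2 * d)%N then (e < e')%N else (e <= e')%N.

(** The shape [mu] varies inside the box of [lam] while the type of fillings stays fixed, as needed
    for removing letters one at a time. *)
Definition is_tab L mu T :=
  [&& [forall i : 'I_d, forall j : 'I_C, (T (i, j) != None) == (j < mu i)%N],
      [forall i : 'I_d, forall j : 'I_C, (j < mu i)%N ==> (ent T (i, j) < L)%N &&
        ((ent T (i, j) < 2 * d) ==> (2 * i <= ent T (i, j)))%N],
      [forall i : 'I_d, forall j : 'I_C, forall j' : 'I_C, (j < j' < mu i)%N ==>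
         row_ok (ent T (i, j)) (ent T (i, j'))] &
      [forall i : 'I_d, forall i' : 'I_d, forall j : 'I_C, [&& i < i', j < mu i & j < mu i']%N ==>
         col_ok (ent T (i, j)) (ent T (i', j))]].

Lemma is_tabP L mu T : reflect
  [/\ forall i j, (T (i, j) != None) = (j < mu i)%N,
      forall i j, (j < mu i)%N -> (ent T (i, j) < L)%N /\
        ((ent T (i, j) < 2 * d)%N -> (2 * i <= ent T (i, j))%N),
      forall i j j', (j < j')%N -> (j' < mu i)%N -> row_ok (ent T (i, j)) (ent T (i, j')) &
      forall i i' j, (i < i')%N -> (j < mu i)%N -> (j < mu i')%N ->
        col_ok (ent T (i, j)) (ent T (i', j))] (is_tab L mu T).
Proof.
apply: (iffP and4P) => -[h1 h2 h3 h4]; split.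
- by move=> i j; exact: (eqP (forallP (forallP h1 i) j)).
- move=> i j ji; move/forallP/(_ i)/forallP/(_ j)/implyP/(_ ji)/andP: h2 => [? /implyP]; split => //.
- by move=> i j j' jj ji; move/forallP/(_ i)/forallP/(_ j)/forallP/(_ j')/implyP: h3; apply; rewrite jj.
- move=> i i' j ii ji ji'; move/forallP/(_ i)/forallP/(_ i')/forallP/(_ j)/implyP: h4.
  by apply; rewrite ii ji.
- by apply/forallP => i; apply/forallP => j; rewrite h1.
- apply/forallP => i; apply/forallP => j; apply/implyP => /h2[-> ?]; exact/implyP.
- apply/forallP => i; apply/forallP => j; apply/forallP => j'; apply/implyP => /andP[]; exact: h3.
- apply/forallP => i; apply/forallP => i'; apply/forallP => j; apply/implyP => /and3P[]; exact: h4.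
Qed.

Definition decr mu := forall i i', (i < i')%N -> (mu i' <= mu i)%N.

(** An unprimed letter occupies a horizontal strip, confined to the rows where it is allowed; a
    primed letter occupies a vertical strip. *)
Definition strip L mu nu :=
  [&& [forall i : 'I_d, nu i <= mu i]%N,
      [forall i : 'I_d, forall i' : 'I_d, (i < i') ==> (nu i' <= nu i)]%N &
      if (L < 2 * d)%N then
        [forall i : 'I_d, (2 * i <= L) || (mu i <= nu i)]%N &&
        [forall i : 'I_d, forall i' : 'I_d, (i < i') ==> (mu i' <= nu i)]%N
      else [forall i : 'I_d, mu i <= (nu i).+1]%N].

Lemma stripP L mu nu : reflect
  [/\ forall i, (nu i <= mu i)%N, decr nu,
      (L < 2 * d)%N -> forall i, (2 * i <= L)%N \/ (mu i <= nu i)%N,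
      (L < 2 * d)%N -> forall i i', (i < i')%N -> (mu i' <= nu i)%N &
      (2 * d <= L)%N -> forall i, (mu i <= (nu i).+1)%N] (strip L mu nu).
Proof.
apply: (iffP and3P) => [[/forallP h1 /forallP h2 h3]|[h1 h2 h3 h4 h5]]; split => //.
- by move=> i i' ii; move/forallP/(_ i')/implyP: (h2 i); apply.
- by move=> h; move: h3; rewrite h => /andP[/forallP h3 _] i; apply/orP.
- move=> h; move: h3; rewrite h => /andP[_ /forallP h3] i i' ii.
  by move/forallP/(_ i')/implyP: (h3 i); apply.
- by move=> h; move: h3; rewrite ltnNge h => /forallP.
- exact/forallP.
- by apply/forallP => i; apply/forallP => i'; apply/implyP => ii; apply: h2.
- case: ltnP => h; last by apply/forallP; apply: h5.
  apply/andP; split; first by apply/forallP => i; apply/orP; apply: h3.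
  by apply/forallP => i; apply/forallP => i'; apply/implyP => ii; apply: h4.
Qed.

Lemma shape_le mu nu i i' :
  (forall j, (j < nu i)%N -> (j < mu i')%N) -> (nu i <= mu i')%N.
Proof.
move=> h; rewrite leqNgt; apply/negP => lt.
have jC : (mu i' < C)%N by apply: leq_trans lt _; rewrite -ltnS.
by have := h (Ordinal jC) lt; rewrite /= ltnn.
Qed.

Definition subshape L T : shape :=
  [ffun i => inord #|[set j | (T (i, j) != None) && (ent T (i, j) < L)%N]|].

Definition erase L T : fill :=
  [ffun c => if T c is Some b then (if (b < L)%N then Some b else None) else None].

Definition fillup (a : 'I_(2 * d + 1)) mu T : fill :=
  [ffun c => if T c is Some b then Some b else if (c.2 < mu c.1)%N then Some a else None].

(** Rows increase weakly, so the letters below [L] fill an initial segment of each row. *)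
Lemma subshapeE L mu T i j : decr mu -> is_tab L.+1 mu T ->
  (T (i, j) != None) && (ent T (i, j) < L)%N = (j < subshape L T i)%N.
Proof.
move=> dmu /is_tabP[h1 h2 h3 h4]; rewrite ffunE inordK; last first.
  by rewrite ltnS -[X in (_ <= X)%N](card_ord C) max_card.
rewrite -down_closed_card ?inE // => a b ab; rewrite !inE h1 h1 => /andP[bm eb].
rewrite (ltn_trans ab bm) /=; have := h3 i a b ab bm.
by rewrite /row_ok; case: ifP => _ h; [exact: leq_ltn_trans h eb | exact: ltn_trans h eb].
Qed.

Lemma subshape_strip (a : 'I_(2 * d + 1)) mu T :
  decr mu -> is_tab a.+1 mu T -> strip a mu (subshape a T).
Proof.
move=> dmu tT; have sE i j := subshapeE i j dmu tT.
move/is_tabP: tT => [h1 h2 h3 h4].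
have a2 : (a <= 2 * d)%N by move: (ltn_ord a); lia.
apply/stripP; split.
- by move=> i; apply: shape_le => j; rewrite -sE h1 => /andP[].
- move=> i i' ii; apply: shape_le => j; rewrite -!sE !h1 => /andP[ji' e].
  have ji := leq_trans ji' (dmu _ _ ii); rewrite ji /=.
  by have := h4 i i' j ii ji ji'; rewrite /col_ok; case: ifP => _; lia.
- move=> ad i; case: (leqP (2 * i) a) => ia; [by left|right].
  apply: shape_le => j ji; rewrite -sE h1 ji /=.
  by have [] := h2 i j ji; lia.
- move=> ad i i' ii; apply: shape_le => j ji'.
  have ji := leq_trans ji' (dmu _ _ ii); rewrite -sE h1 ji /=.
  have [e1 _] := h2 i j ji; have [e2 _] := h2 i' j ji'.
  by have := h4 i i' j ii ji ji'; rewrite /col_ok; case: ifP; lia.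
(* Two cells lost in one row would both contain the primed letter [a], against strictness along
   rows. *)
- move=> ad i; rewrite leqNgt; apply/negP => lt.
  have j2C : ((subshape a T i).+1 < C)%N by apply: leq_trans lt _; rewrite -ltnS.
  have j1C := ltnW j2C.
  have := h3 i (Ordinal j1C) (Ordinal j2C) (ltnSn _) lt.
  have [e2 _] := h2 i (Ordinal j2C) lt.
  have e1 : (a <= ent T (i, Ordinal j1C))%N.
    have := sE i (Ordinal j1C); rewrite /= ltnn h1 /= (ltn_trans (ltnSn _) lt) /=.
    by move=> /negbT; rewrite -leqNgt.
  by rewrite /row_ok; case: ifP; lia.
Qed.

Lemma ent_erase L T c : erase L T c != None -> ent (erase L T) c = ent T c.
Proof. by rewrite /ent ffunE; case: (T c) => // b; case: ifP. Qed.

Lemma erase_some L T c : (erase L T c != None) = (T c != None) && (ent T c < L)%N.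
Proof. by rewrite /ent ffunE; case: (T c) => // b; case: ifP. Qed.

Lemma erase_tab (a : 'I_(2 * d + 1)) mu T :
  decr mu -> is_tab a.+1 mu T -> is_tab a (subshape a T) (erase a T).
Proof.
move=> dmu tT; have sE i j := subshapeE i j dmu tT.
have /stripP[le _ _ _ _] := subshape_strip dmu tT.
move/is_tabP: tT => [h1 h2 h3 h4].
have eE i j : (j < subshape a T i)%N -> ent (erase a T) (i, j) = ent T (i, j).
  by move=> ji; rewrite ent_erase // erase_some sE.
apply/is_tabP; split.
- by move=> i j; rewrite erase_some sE.
- move=> i j ji; rewrite eE //; have [_ hh] := h2 i j (leq_trans ji (le i)).
  by split => //; move: ji; rewrite -sE => /andP[].
- move=> i j j' jj ji; rewrite !eE //; last exact: ltn_trans ji.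
  by apply: h3 => //; apply: leq_trans (le i).
- by move=> i i' j ii ji ji'; rewrite !eE //; apply: h4 => //; apply: leq_trans (le _).
Qed.

Lemma fillupK (a : 'I_(2 * d + 1)) mu T :
  is_tab a.+1 mu T -> fillup a mu (erase a T) = T.
Proof.
move=> /is_tabP[h1 h2 _ _]; apply/ffunP => -[i j]; rewrite !ffunE /=.
have := h1 i j; have := h2 i j; rewrite /ent; case: (T (i, j)) => [b|] /=.
  move=> h /esym hji; case: ltnP => // ab; rewrite hji; congr Some; apply: val_inj => /=.
  by have [] := h hji; lia.
by move=> _ <-.
Qed.

Section FillUp.
Variables (a : 'I_(2 * d + 1)) (mu nu : shape) (T : fill).
Hypotheses (dmu : decr mu) (str : strip a mu nu) (tT : is_tab a nu T).

Lemma fillup_ent i j : (j < mu i)%N ->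
  ent (fillup a mu T) (i, j) = if (j < nu i)%N then ent T (i, j) else a.
Proof.
move: tT => /is_tabP[h1 _ _ _] ji; rewrite /ent ffunE -h1 /=.
by case: (T (i, j)) => //=; rewrite ji.
Qed.

Lemma fillup_some i j : (fillup a mu T (i, j) != None) = (j < mu i)%N.
Proof.
move: tT str => /is_tabP[h1 _ _ _] /stripP[h _ _ _ _]; rewrite ffunE /=.
have := h1 i j; case: (T (i, j)) => [b|] /=; last by case: ifP.
by move=> /esym ji; rewrite (leq_trans ji (h i)).
Qed.

Lemma fillup_tab : is_tab a.+1 mu (fillup a mu T).
Proof.
move: (tT) (str) => /is_tabP[h1 h2 h3 h4] /stripP[s1 s2 s3 s4 s5].
have a2 : (a <= 2 * d)%N by move: (ltn_ord a); lia.
apply/is_tabP; split.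
- exact: fillup_some.
- move=> i j ji; rewrite fillup_ent //; case: (ltnP j (nu i)) => jn.
    by have [e1 e2] := h2 i j jn; split=> //; lia.
  by split=> // ad; case: (s3 ad i) => // h; lia.
- move=> i j j' jj ji'; have ji := ltn_trans jj ji'; rewrite !fillup_ent //.
  case: (ltnP j' (nu i)) => jn'; first by rewrite (ltn_trans jj jn'); apply: h3.
  case: (ltnP j (nu i)) => jn.
    by have [e1 e2] := h2 i j jn; rewrite /row_ok; case: ifP; lia.
  rewrite /row_ok; case: (ltnP a (2 * d)) => // ad; have := s5 ad i; lia.
- move=> i i' j ii ji ji'; rewrite !fillup_ent //; have := s2 _ _ ii => sii.
  case: (ltnP j (nu i')) => jn'; first by rewrite (leq_trans jn' sii); apply: h4 => //; exact: leq_trans jn' sii.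
  case: (ltnP j (nu i)) => jn.
    by have [e1 e2] := h2 i j jn; rewrite /col_ok; case: ifP; lia.
  rewrite /col_ok; case: (ltnP a (2 * d)) => // ad; have := s4 ad _ _ ii; lia.
Qed.

Lemma fillup_subshape : subshape a (fillup a mu T) = nu.
Proof.
move: (tT) (str) => /is_tabP[h1 h2 h3 h4] /stripP[s1 s2 s3 s4 s5].
apply/ffunP => i; apply/val_inj/eqP => /=.
have E j : (j < subshape a (fillup a mu T) i)%N = (j < nu i)%N.
  rewrite -(subshapeE i j dmu fillup_tab) fillup_some.
  case: ltnP => ji /=; last by apply/esym/negbTE; rewrite -leqNgt; apply: leq_trans ji.
  by rewrite fillup_ent //; case: (ltnP j (nu i)) => jn; [have [] := h2 i j jn | rewrite ltnn].
by rewrite eqn_leq !(shape_le (i := i) (i' := i)) // => j; rewrite E.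
Qed.

Lemma eraseK : erase a (fillup a mu T) = T.
Proof.
move: (tT) => /is_tabP[h1 h2 _ _]; apply/ffunP => -[i j]; rewrite !ffunE /=.
have := h1 i j; have := h2 i j; rewrite /ent; case: (T (i, j)) => [b|] /=.
  by move=> h /esym /h [-> _].
by move=> _ _; case: ifP => // _; rewrite ltnn.
Qed.

Lemma fillup_weight : osp_weight x y (fillup a mu T) =
  letter_weight d x y a ^+ (\sum_i mu i - \sum_i nu i) * osp_weight x y T.
Proof.
move: (tT) (str) => /is_tabP[h1 h2 _ _] /stripP[s1 _ _ _ _].
rewrite /osp_weight (bigID (fun c : cell lam => (c.2 < nu c.1)%N)) mulrC /=; congr (_ * _).
  apply: eq_big => [[i j]|[i j]] /=.
    rewrite fillup_some h1 andbC; case: ltnP => // jn; exact: leq_trans jn (s1 i).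
  by rewrite fillup_some => /andP[ji jn]; rewrite fillup_ent // jn.
rewrite (eq_bigr (fun=> letter_weight d x y a)); last first.
  by move=> [i j]; rewrite fillup_some /= => /andP[ji /negbTE jn]; rewrite fillup_ent // jn.
rewrite prodr_const; congr (_ ^+ _).
(* Both sizes are written as sums over the cells of the box, so that their difference is counted
   cell by cell. *)
have E (ka : shape) : (\sum_i ka i = \sum_(c : cell lam) (c.2 < ka c.1))%N.
  rewrite -(pair_bigA _ (fun i j => (j < ka i)%N : nat)) /=; apply: eq_bigr => i _.
  rewrite -big_mkcond /= -(big_ord_widen _ (fun=> 1%N)); last by rewrite -ltnS.
  by rewrite sum1_card card_ord.
rewrite !E -(addKn (\sum_(c : cell lam) (c.2 < nu c.1)%N) #|_|); congr (_ - _)%N.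
rewrite -sum1_card [X in (_ + X)%N]big_mkcond -big_split /=; apply: eq_bigr => -[i j] _.
rewrite unfold_in /= fillup_some; have := s1 i; case: (ltnP j (nu i)); case: (ltnP j (mu i)) => //=; lia.
Qed.
End FillUp.

Definition tab_sum L mu : F := \sum_(T : fill | is_tab L mu T) osp_weight x y T.

(** Tableaux are sorted by the shape left after deleting the letter [a]; [erase] and [fillup] are
    inverse bijections for each such shape. *)
Lemma tab_sum_step (a : 'I_(2 * d + 1)) mu : decr mu ->
  tab_sum a.+1 mu = \sum_(nu : shape | strip a mu nu)
    letter_weight d x y a ^+ (\sum_i mu i - \sum_i nu i) * tab_sum a nu.
Proof.
move=> dmu; rewrite /tab_sum (partition_big (subshape a) (strip a mu)) /=; last first.
  by move=> T; apply: subshape_strip.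
apply: eq_bigr => nu str; rewrite (reindex_onto (fillup a mu) (erase a)) /=; last first.
  by move=> T /andP[tT _]; apply: fillupK.
rewrite big_distrr /=; apply: eq_big => [T|T].
  apply/idP/idP => [/andP[/andP[tT /eqP sT] /eqP eT]|tT].
    by have := erase_tab dmu tT; rewrite sT eT.
  by rewrite (fillup_tab str) // (fillup_subshape dmu str) // (eraseK _ tT) !eqxx.
move=> /andP[/andP[tT /eqP sT] /eqP eT]; rewrite (@fillup_weight a mu nu) //.
by have := erase_tab dmu tT; rewrite sT eT.
Qed.

Lemma tab_sum_empty L mu : (forall i, mu i = 0%N :> nat) -> tab_sum L mu = 1.
Proof.
move=> mu0; rewrite /tab_sum (big_pred1 [ffun=> None]) => [|T].
  by rewrite /osp_weight big1 // => c; rewrite ffunE.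
apply/idP/eqP => [/is_tabP[h _ _ _]|->].
  apply/ffunP => -[i j]; rewrite ffunE; apply/eqP.
  by have := h i j; rewrite mu0 ltn0 => /negbT; rewrite negbK.
by apply/is_tabP; split => [i j|i j|i j j' _|i i' j _]; rewrite ?ffunE mu0.
Qed.

(** A cell of row [i] needs a letter of code at least [2 * i], and none is available. *)
Lemma tab_sum_long k mu i : (k <= d)%N -> (k <= i)%N -> (0 < mu i)%N ->
  tab_sum (2 * k) mu = 0.
Proof.
move=> kd ki mi; rewrite /tab_sum big1 // => T /is_tabP[_ h _ _].
have C0 : (0 < C)%N by apply: leq_trans mi _; rewrite -ltnS.
by have [] := h i (Ordinal C0) mi; lia.
Qed.

(** Requiring the unprimed cells to be closed towards the north-west amounts to ordering the mixed
    pairs, which [row_ok] and [col_ok] already encode. *)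
Lemma osp_tab mu : decr mu -> (forall i, nth 0%N lam i = mu i) ->
  spo d 1 lam x y = tab_sum (2 * d + 1) mu.
Proof.
move=> dmu lmu; apply: eq_bigl => T.
have cE i j : in_diag (i, j) = (j < mu i)%N by rewrite /in_diag lmu.
have mu_le i i' : (i <= i')%N -> (mu i' <= mu i)%N.
  by rewrite leq_eqVlt => /orP[/eqP/val_inj->//|/dmu].
apply/idP/is_tabP => [/and5P[/forallP h1 /forallP h2 /forallP h3 /forallP h4 /and3P[/forallP h5 /forallP h6 /forallP h7]]|[h1 h2 h3 h4]].
  have s1 i j : (T (i, j) != None) = (j < mu i)%N by rewrite -cE; exact: (eqP (h1 _)).
  have uE c : T c != None -> unpr T c = (ent T c < 2 * d)%N by rewrite /unpr /ent; case: (T c).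
  have pE c : T c != None -> prim T c = (2 * d <= ent T c)%N by rewrite /prim /ent; case: (T c).
  have eL c : T c != None -> (ent T c < 2 * d + 1)%N by rewrite /ent; case: (T c) => // b _; apply: ltn_ord.
  split => //.
  - move=> i j; rewrite -s1 => Tc; split; first exact: eL.
    by rewrite -uE // => u; move/implyP/(_ u): (h5 (i, j)).
  - move=> i j j' jj ji'; have ji := ltn_trans jj ji'; move: ji ji'; rewrite -!s1 => t1 t2.
    rewrite /row_ok; case: ltnP => e1; last first.
      have := forallP (h6 (i, j)) (i, j'); rewrite !pE //= eqxx jj e1 /= andbT.
      case: (leqP (2 * d) (ent T (i, j'))) => //= e2 _; have := forallP (h2 (i, j)) (i, j').
      by rewrite !uE // e2 /= leqnn (ltnW jj) /=; lia.
    have := forallP (h3 (i, j)) (i, j'); rewrite !uE //= eqxx jj e1 /= andbT.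
    by case: (ltnP (ent T (i, j')) (2 * d)) => //=; lia.
  - move=> i i' j ii; rewrite -!s1 => t1 t2.
    rewrite /col_ok; case: ltnP => e1; last first.
      have := forallP (h7 (i, j)) (i', j); rewrite !pE //= eqxx ii e1 /= andbT.
      case: (leqP (2 * d) (ent T (i', j))) => //= e2 _; have := forallP (h2 (i, j)) (i', j).
      by rewrite !uE // e2 /= leqnn (ltnW ii) /=; lia.
    have := forallP (h4 (i, j)) (i', j); rewrite !uE //= eqxx ii e1 /= andbT.
    by case: (ltnP (ent T (i', j)) (2 * d)) => //=; lia.
have s1 i j : T (i, j) != None -> (j < mu i)%N by rewrite h1.
have uE c : unpr T c -> T c != None /\ (ent T c < 2 * d)%N by rewrite /unpr /ent; case: (T c).
have pE c : prim T c -> T c != None /\ (2 * d <= ent T c)%N by rewrite /prim /ent; case: (T c).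
have uE' c : T c != None -> unpr T c = (ent T c < 2 * d)%N by rewrite /unpr /ent; case: (T c).
(* Letters of either kind increase weakly in both directions, so a cell north-west of an unprimed
   cell is unprimed. *)
have r_le i j j' : (j <= j')%N -> (j' < mu i)%N -> (ent T (i, j) <= ent T (i, j'))%N.
  rewrite leq_eqVlt => /orP[/eqP/val_inj->//|jj ji].
  by have := h3 i j j' jj ji; rewrite /row_ok; case: ifP; lia.
have c_le i i' j : (i <= i')%N -> (j < mu i')%N -> (ent T (i, j) <= ent T (i', j))%N.
  rewrite leq_eqVlt => /orP[/eqP/val_inj->//|ii ji].
  have := h4 i i' j ii (leq_trans ji (dmu _ _ ii)) ji; rewrite /col_ok; case: ifP; lia.
apply/and5P; split; [| | | |apply/and3P; split]; apply/forallP => -[i j]; rewrite ?h1 ?cE ?eqxx //.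
all: try (apply/forallP => -[i' j']); apply/implyP; rewrite /=.
- move=> /and3P[/uE[t2 u2] ii jj].
  have ji' := s1 _ _ t2; have ji := leq_ltn_trans jj (leq_trans ji' (mu_le _ _ ii)).
  rewrite uE' ?h1 //; apply: leq_ltn_trans u2.
  apply: leq_trans (c_le _ _ _ ii ji'); apply: r_le => //.
  exact: leq_trans ji' (mu_le _ _ ii).
- move=> /and4P[/uE[t1 u1] /uE[t2 u2] /eqP ii jj]; subst i'.
  by apply: r_le; [exact: ltnW | exact: s1].
- move=> /and4P[/uE[t1 u1] /uE[t2 u2] /eqP jj ii]; subst j'.
  by have := h4 i i' j ii (s1 _ _ t1) (s1 _ _ t2); rewrite /col_ok u1.
- by move=> /uE[/s1 t1 u1]; have [_] := h2 i j t1; apply.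
- move=> /and4P[/pE[t1 u1] /pE[t2 u2] /eqP ii jj]; subst i'.
  by have := h3 i j j' jj (s1 _ _ t2); rewrite /row_ok ltnNge u1.
- move=> /and4P[/pE[t1 u1] /pE[t2 u2] /eqP jj ii]; subst j'.
  by apply: c_le; [exact: ltnW | exact: s1].
Qed.

End Tableaux.

(** * The bialternant formula for orthosymplectic Schur functions *)

Section DtOps.
Variable F : fieldType.

(** Subtracting from each column the next one turns the bordering row of ones into a unit row. *)
Lemma dt_diff k (g : nat -> nat -> F) :
  dt k (fun i j => g i j - g i j.+1) = dt k.+1 (fun i j => if (i < k)%N then g i j else 1).
Proof.
pose U (l j : nat) : F := (l == j)%:R - (l == j.+1)%:R.
have dU : dt k.+1 U = 1.
  apply: dt_trig1 => [i j /andP[ij jk]|i ik]; rewrite /U.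
    by rewrite !ltn_eqF ?subrr //; lia.
  by rewrite eqxx ltn_eqF ?subr0 //; lia.
rewrite -[RHS]mulr1 -[X in _ = _ * X]dU -dt_mul.
have E (f : nat -> F) (j : nat) : \sum_(l < k.+1) f l * U l j = (if (j < k.+1)%N then f j else 0) - (if (j < k)%N then f j.+1 else 0) :> F.
  under eq_bigr => l _ do rewrite mulrBr.
  rewrite big_split /= sumrN; congr (_ - _).
    case: ltnP => h; first exact: sum_delta_r.
    by rewrite big1 // => l _; rewrite ltn_eqF ?mulr0 //; apply: leq_trans h.
  case: ltnP => h; first by apply: sum_delta_r.
  by rewrite big1 // => l _; rewrite ltn_eqF ?mulr0 //; move: (ltn_ord l); lia.
rewrite -addn1 [RHS]dt_ublock => [|i j i1 jk]; last first.
  have ki : (k + i < k)%N = false by lia.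
  by rewrite addn1 (E (fun l => if (k + i < k)%N then g (k + i)%N l else 1)) jk leqW // ki subrr.
rewrite [X in _ * X](_ : _ = 1) ?mulr1; last first.
  rewrite /dt det_mx11 mxE addn1 (E (fun l => if (k + 0 < k)%N then g (k + 0)%N l else 1)) !addn0.
  by rewrite ltnSn ltnn subr0.
apply: dt_ext => i j ik jk; rewrite addn1 (E (fun l => if (i < k)%N then g i l else 1)) ik jk.
by rewrite leqW.
Qed.

Lemma dt_diff0 k (g : nat -> nat -> F) : (forall i, (i < k)%N -> g i k = 0) ->
  dt k (fun i j => g i j - g i j.+1) = dt k g.
Proof.
move=> g0; rewrite dt_diff -addn1 dt_lblock => [|i j ik j1].
  rewrite [X in _ * X](_ : _ = 1) ?mulr1.
    by apply: dt_ext => i j ->.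
  by rewrite /dt det_mx11 mxE addn0 ltnn.
by rewrite ik (_ : j = 0)%N ?addn0 ?g0 //; lia.
Qed.

Lemma dt_subrow k (f : nat -> nat -> F) :
  dt k.+1 (fun i j => if (i < k)%N then f i j - f k j else f i j) = dt k.+1 f.
Proof.
pose U (i l : nat) : F := (l == i)%:R - ((i < k)%N && (l == k))%:R.
have dU : dt k.+1 U = 1.
  apply: dt_trig1T => [i j /andP[ji ik]|i ik]; rewrite /U.
    by rewrite !ltn_eqF ?andbF ?subrr //; lia.
  by rewrite eqxx; case: ltnP => h; rewrite ?subr0 //= ltn_eqF ?subr0.
rewrite -[RHS]mul1r -[X in _ = X * _]dU -dt_mul; apply: dt_ext => i j ik jk.
rewrite /U; under eq_bigr => l _ do rewrite mulrBl.
rewrite big_split /= sumrN (sum_delta (fun l => f l j)) //.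
case: ifP => _; last by rewrite big1 ?subr0 // => l _; rewrite mul0r.
by congr (_ - _); rewrite (sum_delta (fun l => f l j)).
Qed.

Lemma sum_shift lo hi s (g : nat -> F) : (lo <= hi)%N ->
  \sum_(lo <= b < hi) g (b + s)%N = \sum_(b < hi + s) g b - \sum_(b < lo + s) g b.
Proof.
move=> lh; rewrite -!(big_mkord xpredT) [X in X - _](@big_cat_nat _ _ _ (lo + s)) //=; last lia.
by rewrite addrAC subrr add0r big_addn addnK.
Qed.

Lemma exprB_inv (x : F) a b : x != 0 -> (b <= a)%N -> x ^+ (a - b) = x ^+ a * x^-1 ^+ b.
Proof. by move=> x0 ba; rewrite -{2}(subnK ba) exprD exprVn mulfK // expf_neq0. Qed.

(** An indefinite sum: with it, the sum over one row length of the removed strip is a difference of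
    two values. *)
Definition gsum (t y : F) c := \sum_(b < c) y ^+ b * cheb t b.

(** Multiplied by [t - (x + x^-1)], the sum telescopes through the Chebyshev recurrence. *)
Lemma gsum_cheb t x c : x != 0 ->
  (t - (x + x^-1)) * gsum t x^-1 c.+1 = x^-1 ^+ c * cheb t c.+1 - x^-1 ^+ c.+1 * cheb t c - 1.
Proof.
move=> x0; have xy : x * x^-1 = 1 by rewrite divff.
elim: c => [|c IH]; first by rewrite /gsum big_ord_recr big_ord0 /cheb /=; ring.
rewrite /gsum big_ord_recr /= -/(gsum _ _ _) mulrDr IH chebSS !exprS.
move: (x^-1) xy => y xy; move: (cheb t c.+1) (cheb t c) (y ^+ c) => A B Y.
apply/eqP; rewrite -subr_eq0; apply/eqP.
(* With [x^-1] replaced by a variable [y], the two sides differ by a multiple of [1 - x * y], which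
   is zero. *)
transitivity ((1 - x * y) * Y * A); first by ring.
by rewrite xy subrr !mul0r.
Qed.

(** The second telescoping: by [gsum_cheb] the summand is a difference of consecutive terms
    [x ^+ c.+1 * cheb t c], less [x ^+ (2 * c.+1)]. *)
Lemma hsum_cheb_aux t x a : x != 0 ->
  (t - (x + x^-1)) * (\sum_(c < a) x ^+ (2 * c.+1) * gsum t x^-1 c.+1) =
  x ^+ a.+1 * cheb t a - \sum_(c < a) x ^+ (2 * c.+1).
Proof.
move=> x0; have xy : x * x^-1 = 1 by rewrite divff.
elim: a => [|a IH]; first by rewrite !big_ord0 /cheb /= !mulr0 subr0.
rewrite !big_ord_recr /= mulrDr IH mulrCA gsum_cheb //.
have E : x ^+ (2 * a.+1) * x^-1 ^+ a = x ^+ a.+2.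
  by rewrite -exprB_inv //; [congr (_ ^+ _) | ]; lia.
have E' : x ^+ (2 * a.+1) * x^-1 ^+ a.+1 = x ^+ a.+1.
  by rewrite -exprB_inv //; [congr (_ ^+ _) | ]; lia.
rewrite !mulrBr !mulrA E E'; ring.
Qed.

(** The previous identity at [t = x + x^-1], where its left-hand side vanishes. *)
Lemma hsum_one (x : F) a : x != 0 ->
  \sum_(c < a) x ^+ (2 * c.+1) = x ^+ a.+1 * cheb (x + x^-1) a.
Proof.
by move=> x0; apply/eqP; rewrite eq_sym -subr_eq0 -(hsum_cheb_aux (x + x^-1)) // subrr mul0r.
Qed.

Lemma hsum_cheb t x a : x != 0 ->
  (t - (x + x^-1)) * (\sum_(c < a) x ^+ (2 * c.+1) * gsum t x^-1 c.+1) =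
  x ^+ a.+1 * (cheb t a - cheb (x + x^-1) a).
Proof. by move=> x0; rewrite hsum_cheb_aux // hsum_one // mulrBr. Qed.

End DtOps.

(** * Row lengths and sums over strips *)

Section Shapes.
Variables (F : fieldType) (lam : seq nat).
Local Notation d := (size lam).
Local Notation C := (ncols lam).
Local Notation shape := {ffun 'I_d -> 'I_C.+1}.
Implicit Types (mu nu la : shape).

Definition rowlen mu j : nat := if insub j is Some i then mu i else 0%N.

Lemma rowlen_ord mu (i : 'I_d) : rowlen mu i = mu i.
Proof. by rewrite /rowlen valK. Qed.

Lemma rowlen_ge mu j : (d <= j)%N -> rowlen mu j = 0%N.
Proof. by move=> dj; rewrite /rowlen insubN // -leqNgt. Qed.

Lemma rowlen_le mu j : (rowlen mu j <= C)%N.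
Proof. by rewrite /rowlen; case: insub => [i|//]; rewrite -ltnS. Qed.

Lemma rowlen_dec mu j j' : decr mu -> (j <= j')%N -> (rowlen mu j' <= rowlen mu j)%N.
Proof.
move=> dmu; rewrite leq_eqVlt => /orP[/eqP->//|jj].
case: (ltnP j' d) => h; last by rewrite rowlen_ge.
by have := dmu (Ordinal (ltn_trans jj h)) (Ordinal h) jj; rewrite -!rowlen_ord.
Qed.

Lemma sum_rowlen k mu : (k <= d)%N -> (forall i : 'I_d, (k <= i)%N -> mu i = 0%N :> nat) ->
  (\sum_i mu i = \sum_(j < k) rowlen mu j)%N.
Proof.
move=> kd mu0; rewrite (big_ord_widen _ (rowlen mu) kd) [RHS]big_mkcond /=.
by apply: eq_bigr => i _; rewrite rowlen_ord; case: ltnP => // /mu0.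
Qed.

Definition rows_in k (lo hi : nat -> nat) (j : 'I_d) (b : 'I_C.+1) : bool :=
  if (j < k)%N then (lo j <= b <= hi j)%N else b == 0%N :> nat.

(** A shape confined by intervals is an independent choice of row lengths, so multilinearity moves
    the sum into the columns. *)
Lemma dt_rows k lo hi (A : nat -> nat -> nat -> F) : (k <= d)%N ->
  (forall j, (hi j <= C)%N) ->
  \sum_(nu : shape | nu \in family (rows_in k lo hi)) dt k (fun i j => A i j (rowlen nu j)) =
  dt k (fun i j => \sum_(lo j <= b < (hi j).+1) A i j b).
Proof.
move=> kd hC.
(* Shapes have [d] rows, so the determinant of size [k] is enlarged by an identity block before
   applying [det_family]. *)
pose pad (f : nat -> nat -> F) (i j : nat) := if (i < k)%N && (j < k)%N then f i j else (i == j)%:R.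
have padE f : dt k f = \det (\matrix_(i < d, j < d) pad f i j).
  rewrite -/(dt d (pad f)) -(subnKC kd) dt_ublock => [|i j _ jk]; last first.
    by rewrite /pad jk andbT ifF ?gtn_eqF //; lia.
  rewrite [X in _ * X](_ : _ = 1) ?mulr1.
    by apply: dt_ext => i j ik jk; rewrite /pad ik jk.
  rewrite -[RHS](dt_id F (d - k)); apply: dt_ext => i j ik jk.
  by rewrite /pad ifF ?eqn_add2l //; lia.
pose B (i j : 'I_d) (b : 'I_C.+1) := if (i < k)%N && (j < k)%N then A i j b else (i == j :> nat)%:R.
transitivity (\sum_(nu : shape | nu \in family (rows_in k lo hi)) \det (\matrix_(i, j) B i j (nu j))).
  apply: eq_bigr => nu _; rewrite padE; congr (\det _); apply/matrixP => i j.
  by rewrite !mxE /pad /B rowlen_ord.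
rewrite det_family padE; congr (\det _); apply/matrixP => i j; rewrite !mxE /pad /B /rows_in.
case: (ltnP j k) => jk; rewrite ?andbT ?andbF; last first.
  by rewrite (big_pred1 ord0) // => b; rewrite -val_eqE.
case: (ltnP i k) => ik.
  rewrite (big_nat_widenl _ 0%N) // (big_nat_widen _ _ C.+1) ?ltnS // big_mkord.
  by apply: eq_bigl => b; rewrite ltnS.
have ij : (i == j :> nat) = false by rewrite gtn_eqF //; lia.
by rewrite big1 ?ij // => b _; rewrite ij.
Qed.

(** Interlacing makes horizontal strips a product of intervals. Here [K = k] serves the removal of
    the letter [2 * k], after which row [k] must be empty, and [K = k.+1] that of its barred
    partner. *)
Lemma strip_rows k K (a : nat) la nu : (k < d)%N -> decr la ->
  (forall i : 'I_d, (k < i)%N -> la i = 0%N :> nat) -> (k <= K <= k.+1)%N -> (2 * k <= a < 2 * k.+1)%N ->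
  strip a la nu && [forall i : 'I_d, (K <= i)%N ==> (nu i == 0%N :> nat)] =
  (nu \in family (rows_in K (fun j => rowlen la j.+1) (rowlen la))).
Proof.
move=> kd dla la0 kK ak; have ad : (a < 2 * d)%N by lia.
apply/idP/familyP => [/andP[/stripP[s1 s2 s3 s4 _] /forallP n0] j|h].
  rewrite unfold_in /rows_in; case: ltnP => jK; last by have := n0 j; rewrite jK.
  rewrite rowlen_ord s1 andbT; case: (ltnP j.+1 d) => jd; last by rewrite rowlen_ge.
  by have := s4 ad j (Ordinal jd) (ltnSn _); rewrite -rowlen_ord.
have h1 (i : 'I_d) : (i < K)%N -> (rowlen la i.+1 <= nu i <= la i)%N.
  by move=> iK; have := h i; rewrite unfold_in /rows_in iK rowlen_ord.
have h2 (i : 'I_d) : (K <= i)%N -> nu i = 0%N :> nat.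
  by move=> iK; have := h i; rewrite unfold_in /rows_in ltnNge iK => /eqP.
have le (i : 'I_d) : (nu i <= la i)%N by case: (ltnP i K) => [/h1/andP[]//|/h2->].
have s4 (i i' : 'I_d) : (i < i')%N -> (la i' <= nu i)%N.
  move=> ii; case: (ltnP i K) => iK; last by rewrite la0 //; lia.
  have /andP[l1 _] := h1 i iK; apply: leq_trans l1.
  by rewrite -rowlen_ord; apply: rowlen_dec.
apply/andP; split; last by apply/forallP => i; apply/implyP => /h2 ->.
apply/stripP; split => //; last by lia.
- by move=> i i' ii; apply: leq_trans (le _) (s4 _ _ ii).
- move=> _ i; case: (leqP (2 * i) a) => ia; [by left|right].
  by rewrite la0 //; lia.
Qed.

(** * Determinants for tableau sums, by induction on the letters *)

Section Branching.
Variables (x : nat -> F) (z : F).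
Let y := fun _ : nat => z.
Let t i := x i + (x i)^-1.
Let Z L mu := tab_sum x y L mu.
Let den k := dt k (fun i j => cheb (t i) (k - j)).
Let num k mu := dt k (fun i j => cheb (t i) (rowlen mu j + (k - j))).
Let wt mu := (\sum_i mu i)%N.
Let stair k := (\sum_(j < k) (k - j))%N.

Let stairS k : stair k.+1 = (k.+1 + stair k)%N.
Proof. by rewrite /stair big_ord_recl subn0; congr addn; apply: eq_bigr => j _; rewrite subSS. Qed.

(** The symplectic Weyl character formula in the first [k] variables, with the factors
    [x i - (x i)^-1] cancelled and the denominator multiplied out. *)
Let Weyl k := forall mu, decr mu -> (forall i : 'I_d, (k <= i)%N -> mu i = 0%N :> nat) ->
  den k * Z (2 * k) mu = num k mu.

Let wt_le a la nu : strip a la nu -> (wt nu <= wt la)%N.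
Proof. by case/stripP=> le _ _ _ _; apply: leq_sum. Qed.

(** Removing the unbarred letter sums each column over an interval. The result is a difference of
    values of [gsum], and [dt_diff] trades the differences for a row of ones. *)
Let Weyl_barless (k : nat) nu : (k < d)%N -> x k != 0 -> Weyl k -> decr nu ->
  (forall i : 'I_d, (k < i)%N -> nu i = 0%N :> nat) ->
  den k * Z (2 * k + 1) nu = x k ^+ wt nu * x k ^+ stair k *
    dt k.+1 (fun i j => if (i < k)%N then gsum (t i) (x k)^-1 (rowlen nu j + (k.+1 - j)) else 1).
Proof.
move=> kd xk W dnu nu0.
have ad : (2 * k < 2 * d + 1)%N by lia.
rewrite /Z addn1 (tab_sum_step x y (Ordinal ad) dnu) /= big_distrr /=.
(* A shape with a cell in a row of index at least [k] has no tableau in the remaining [2 * k]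
   letters. *)
rewrite (bigID (fun mu : shape => [forall i : 'I_d, (k <= i)%N ==> (mu i == 0%N :> nat)])) /=.
rewrite [X in _ + X]big1 ?addr0; last first.
  move=> mu /andP[_ /forallPn[i]]; rewrite negb_imply => /andP[ki mi].
  by rewrite (@tab_sum_long _ _ _ _ k mu i) ?mulr0 ?lt0n // ltnW.
have -> : letter_weight d x y (2 * k) = x k.
  by rewrite /letter_weight ifT ?mul2n ?odd_double ?doubleK //; lia.
rewrite (eq_bigl _ _ (fun mu => strip_rows mu kd dnu nu0 _ _)); try lia.
rewrite (eq_bigr (fun mu : shape => x k ^+ wt nu *
   dt k (fun i j => (x k)^-1 ^+ rowlen mu j * cheb (t i) (rowlen mu j + (k - j))))); last first.
  move=> mu; rewrite -(strip_rows mu kd dnu nu0 (a := 2 * k)); try lia.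
  case/andP => str /forallP m0.
  have mu0 (i : 'I_d) : (k <= i)%N -> mu i = 0%N :> nat by move=> ki; apply/eqP; apply: (implyP (m0 i)).
  rewrite exprB_inv //; last exact: wt_le str.
  rewrite mulrCA W //; last by case/stripP: str.
  rewrite -mulrA; congr (_ * _); rewrite (dt_scalec _ (fun j => (x k)^-1 ^+ rowlen mu j)).
  by rewrite prodrXr; congr (_ ^+ _ * _); apply: sum_rowlen => //; apply: ltnW.
rewrite -big_distrr /= -mulrA; congr (_ * _).
rewrite (@dt_rows k _ _ (fun i j b => (x k)^-1 ^+ b * cheb (t i) (b + (k - j)))); first last.
- by move=> j; apply: rowlen_le.
- exact: ltnW.
rewrite -dt_diff.
have -> : dt k (fun i j => gsum (t i) (x k)^-1 (rowlen nu j + (k.+1 - j)) -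
     gsum (t i) (x k)^-1 (rowlen nu j.+1 + (k.+1 - j.+1))) =
   dt k (fun i j => (x k)^-1 ^+ (k - j) * \sum_(rowlen nu j.+1 <= b < (rowlen nu j).+1)
      (x k)^-1 ^+ b * cheb (t i) (b + (k - j))).
  apply: dt_ext => i j ik jk; rewrite subSS big_distrr /=.
  rewrite (eq_bigr (fun b => (x k)^-1 ^+ (b + (k - j)) * cheb (t i) (b + (k - j)))).
    rewrite (@sum_shift _ _ _ _ (fun b => (x k)^-1 ^+ b * cheb (t i) b)).
      by rewrite /gsum addSnnS -subSn // ltnW.
    by rewrite leqW // rowlen_dec.
  by move=> b _; rewrite mulrA -exprD addnC.
by rewrite (dt_scalec _ (fun j => (x k)^-1 ^+ (k - j))) prodrXr mulrA exprVn divff ?mul1r // expf_neq0.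
Qed.

(** Removing the barred letter sums the columns of [Weyl_barless] once more. Multiplying row [i < k]
    by [t i - t k] turns them into differences of Chebyshev values, from which the last row is added
    back. *)
Let Weyl_bar (k : nat) la : (k < d)%N -> x k != 0 -> Weyl k -> decr la ->
  (forall i : 'I_d, (k < i)%N -> la i = 0%N :> nat) ->
  (\prod_(i < k) (t i - t k)) * den k * Z (2 * k.+1) la = num k.+1 la.
Proof.
move=> kd xk W dla la0.
have ad : (2 * k + 1 < 2 * d + 1)%N by lia.
have -> : (2 * k.+1 = (2 * k + 1).+1)%N by lia.
pose g i c := if (i < k)%N then gsum (t i) (x k)^-1 c else 1.
have step : den k * Z (2 * k + 1).+1 la = (x k)^-1 ^+ wt la * x k ^+ stair k *
    dt k.+1 (fun i j => \sum_(rowlen la j.+1 <= b < (rowlen la j).+1)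
       x k ^+ (2 * b) * g i (b + (k.+1 - j))%N).
  rewrite /Z (tab_sum_step x y (Ordinal ad) dla) /= big_distrr /=.
  have -> : letter_weight d x y (2 * k + 1) = (x k)^-1.
    rewrite /letter_weight ifT; last lia.
    by rewrite addn1 mul2n /= odd_double /= uphalf_double.
  rewrite (eq_bigl (fun nu : shape => strip (2 * k + 1) la nu && [forall i : 'I_d, (k.+1 <= i)%N ==> (nu i == 0%N :> nat)])); last first.
    move=> nu; case: (boolP (strip _ _ _)) => //= /stripP[le _ _ _ _].
    by apply/esym/forallP => i; apply/implyP => /la0 ki; rewrite -leqn0 -[X in (_ <= X)%N]ki.
  rewrite (eq_bigl _ _ (fun mu => strip_rows mu kd dla la0 _ _)); try lia.
  rewrite -(@dt_rows k.+1 _ _ (fun i j b => x k ^+ (2 * b) * g i (b + (k.+1 - j))%N)) //; last first.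
    by move=> j; apply: rowlen_le.
  rewrite big_distrr /=; apply: eq_bigr => nu.
  rewrite -(strip_rows nu kd dla la0 (a := 2 * k + 1)); try lia.
  case/andP => str /forallP n0.
  have nu0 (i : 'I_d) : (k < i)%N -> nu i = 0%N :> nat by move=> ki; apply/eqP; apply: (implyP (n0 i)).
  have dnu : decr nu by case/stripP: str.
  rewrite exprB_inv ?invr_eq0 ?invrK //; last exact: wt_le str.
  rewrite mulrCA Weyl_barless // (dt_scalec _ (fun j => x k ^+ (2 * rowlen nu j))) prodrXr.
  (* One factor [x k ^+ wt nu] comes from the unbarred letter, the other from the negative exponent
     of the barred one. *)
  have -> : (\sum_(i < k.+1) 2 * rowlen nu i = wt nu + wt nu)%N.
    by rewrite -big_distrr /= /wt (sum_rowlen (k := k.+1)) // mul2n addnn.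
  rewrite exprD /g; ring.
pose hs i a := \sum_(c < a) x k ^+ (2 * c.+1) * g i c.+1.
pose al j := (rowlen la j + (k.+1 - j))%N.
(* The power of [x k] raises the exponents to match the shifted index of [g], so that column [j]
   becomes a difference of values of [hs]. *)
have hs_diff : x k ^+ (2 * stair k.+1) * dt k.+1 (fun i j => \sum_(rowlen la j.+1 <= b < (rowlen la j).+1)
       x k ^+ (2 * b) * g i (b + (k.+1 - j))%N) = dt k.+1 (fun i j => hs i (al j)).
  rewrite -(dt_diff0 (g := fun i j => hs i (al j))); last first.
    (* The column after the last is an empty sum, as [dt_diff0] requires. *)
    have r0 : rowlen la k.+1 = 0%N.
      case: (ltnP k.+1 d) => [h|]; last exact: rowlen_ge.
      by rewrite -[k.+1]/(val (Ordinal h)) rowlen_ord la0.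
    by move=> i _; rewrite /al /hs r0 subnn big_ord0.
  have -> : x k ^+ (2 * stair k.+1) = \prod_(j < k.+1) x k ^+ (2 * (k.+1 - j)).
    by rewrite prodrXr -big_distrr.
  rewrite -(dt_scalec _ (fun j => x k ^+ (2 * (k.+1 - j)))); apply: dt_ext => i j ik jk.
  rewrite big_distrr /=.
  rewrite (eq_bigr (fun b => x k ^+ (2 * (b + (k - j)).+1) * g i (b + (k - j)).+1)); last first.
    move=> b _; rewrite mulrA -exprD; congr (_ ^+ _ * g _ _); lia.
  rewrite (@sum_shift _ _ _ _ (fun b => x k ^+ (2 * b.+1) * g i b.+1)); last by rewrite leqW // rowlen_dec.
  by rewrite /hs /al subSS addSnnS -subSn.
have hs_cheb : (\prod_(i < k) (t i - t k)) * dt k.+1 (fun i j => hs i (al j)) =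
    x k ^+ (wt la + stair k.+1 + k.+1) * num k.+1 la.
  have -> : \prod_(i < k) (t i - t k) = \prod_(i < k.+1) (if (i < k)%N then t i - t k else 1).
    rewrite big_ord_recr /= ltnn mulr1; apply: eq_bigr => i _; by rewrite ltn_ord.
  rewrite -(dt_scaler _ (fun i => if (i < k)%N then t i - t k else 1)).
  have -> : x k ^+ (wt la + stair k.+1 + k.+1) = \prod_(j < k.+1) x k ^+ (al j).+1.
    rewrite prodrXr; congr (_ ^+ _); rewrite /wt (sum_rowlen (k := k.+1)) // /stair -big_split /=.
    rewrite [RHS](eq_bigr (fun j : 'I_k.+1 => al j + 1)%N) => [|j _]; last by rewrite addn1.
    by rewrite [RHS]big_split /= sum1_card card_ord.
  rewrite /num -(dt_subrow _ (fun i j => cheb (t i) (rowlen la j + (k.+1 - j)))).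
  rewrite -(dt_scalec _ (fun j => x k ^+ (al j).+1)); apply: dt_ext => i j ik jk.
  rewrite /hs /g; case: ltnP => h; first by rewrite hsum_cheb.
  have -> : i = k by lia.
  by rewrite mul1r; under eq_bigr => c _ do rewrite mulr1; rewrite hsum_one.
apply: (mulfI (expf_neq0 (2 * stair k.+1) xk)).
have E : (x k)^-1 ^+ wt la * x k ^+ stair k * x k ^+ (wt la + stair k.+1 + k.+1) = x k ^+ (2 * stair k.+1).
  rewrite -mulrA -exprD (_ : (stair k + (wt la + stair k.+1 + k.+1) = wt la + 2 * stair k.+1)%N).
    by rewrite exprD mulrA exprVn mulVf ?mul1r // expf_neq0.
  by rewrite stairS; lia.
rewrite -[in RHS]E -[RHS]mulrA -hs_cheb -hs_diff -mulrA step; ring.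
Qed.

Hypothesis x_neq0 : forall i, (i < d)%N -> x i != 0.

Let Weyl_all k : (k <= d)%N -> Weyl k.
Proof.
elim: k => [|k IH] kd mu dmu mu0.
  by rewrite /den /num /dt !det_mx00 mul1r /Z tab_sum_empty // => i; apply: mu0.
have W := IH (ltnW kd); have xk := x_neq0 kd.
rewrite -(Weyl_bar kd xk W dmu) //; congr (_ * _).
(* For the empty shape the tableau sum is 1, so [Weyl_bar] itself evaluates the product of the
   [t i - t k] with [den k] as [den k.+1]. *)
pose nil : shape := [ffun=> ord0].
have nil0 (i : 'I_d) : nil i = 0%N :> nat by rewrite ffunE.
have := @Weyl_bar k nil kd xk W _ (fun i _ => nil0 i).
rewrite /Z tab_sum_empty // mulr1 => ->; last by move=> i i' _; rewrite !nil0.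
apply: dt_ext => i j ik jk; congr cheb.
by rewrite /rowlen; case: insub => // l; rewrite nil0.
Qed.

(** Unlike for horizontal strips, the intervals do not force [nu] to be decreasing; this remains as
    a separate condition. *)
Lemma strip_vertical la nu : decr la ->
  strip (2 * d) la nu =
  (nu \in family (rows_in d (fun j => (rowlen la j).-1) (rowlen la))) &&
  [forall i : 'I_d, rowlen nu i.+1 <= nu i]%N.
Proof.
move=> dla; apply/stripP/andP => [[s1 s2 _ _ s5]|[/familyP h /forallP a]].
  split.
    apply/familyP => i; rewrite unfold_in /rows_in ltn_ord !rowlen_ord s1 andbT.
    by have := s5 (leqnn _) i => /=; rewrite ?rowlen_ord; lia.
  by apply/forallP => i; rewrite -rowlen_ord; apply: rowlen_dec.
have h1 (i : 'I_d) : ((la i).-1 <= nu i <= la i)%N.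
  by have := h i; rewrite unfold_in /rows_in ltn_ord !rowlen_ord.
split; try lia.
- by move=> i; case/andP: (h1 i).
- move=> i i' ii; rewrite -!rowlen_ord; have [e] : exists e, i' = (i + e)%N :> nat by exists (i' - i)%N; lia.
  move=> ->; elim: e => [|e IHe]; first by rewrite addn0.
  apply: leq_trans IHe; rewrite addnS.
  case: (ltnP (i + e) d) => ie; last by rewrite rowlen_ge //; lia.
  by have := a (Ordinal ie); rewrite -rowlen_ord.
- by move=> _ i; case/andP: (h1 i); lia.
Qed.

(* A row of length 0 cannot lose a cell, so its column lacks the term in z; that
   term is z times the next column and is restored by column operations. *)
Let dt_primed la : decr la ->
  dt d (fun i j => \sum_((rowlen la j).-1 <= b < (rowlen la j).+1)
     z ^+ (rowlen la j - b) * cheb (t i) (b + (d - j))) =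
  dt d (fun i j => zcheb z (rowlen la j + (d - 1 - j)) (t i)).
Proof.
move=> dla; pose U (l j : nat) : F := (l == j)%:R + z * ((rowlen la j == 0%N) && (l == j.+1))%:R.
have dU : dt d U = 1.
  apply: dt_trig1 => [i j /andP[ij jd]|i id]; rewrite /U.
    by rewrite (ltn_eqF ij) (ltn_eqF (ltnW ij : i < j.+1)%N) andbF mulr0 addr0.
  by rewrite eqxx (ltn_eqF (ltnSn i)) andbF mulr0 addr0.
rewrite -[LHS]mulr1 -[X in _ * X = _]dU -dt_mul; apply: dt_ext => i j id jd.
set E := fun l => \sum_((rowlen la l).-1 <= b < (rowlen la l).+1)
     z ^+ (rowlen la l - b) * cheb (t i) (b + (d - l)).
rewrite (eq_bigr (fun l : 'I_d => E l * (l == j :> nat)%:R +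
   z * (rowlen la j == 0%N)%:R * (E l * (l == j.+1 :> nat)%:R))); last first.
  by move=> l _; rewrite /U -mulnb natrM -/(E l); ring.
rewrite big_split /= -big_distrr /= (sum_delta_r E jd).
have E0 l : rowlen la l = 0%N -> E l = cheb (t i) (d - l).
  by move=> l0; rewrite /E l0 /= big_nat1 subnn expr0 mul1r add0n.
rewrite /zcheb; case: (posnP (rowlen la j)) => lj; last first.
  rewrite mulr0 mul0r addr0 /E (@big_nat_recr _ _ _ (rowlen la j)) /=; last lia.
  rewrite (_ : \sum_(_ <= _ < rowlen la j) _ = z * cheb (t i) (rowlen la j + (d - 1 - j))).
    by rewrite subnn expr0 mul1r addrC; congr (cheb _ _ + _); lia.
  rewrite -{2}(prednK lj) big_nat1; congr (_ * cheb _ _); last lia.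
  by rewrite (_ : (_ - _ = 1)%N) ?expr1 //; lia.
rewrite mulr1 E0 // lj add0n; congr (cheb _ _ + _ * _); first lia.
case: (ltnP j.+1 d) => j1.
  rewrite (sum_delta_r E j1) E0; first by congr cheb; lia.
  by apply/eqP; rewrite -leqn0 -[X in (_ <= X)%N]lj rowlen_dec.
(* For [j = d - 1] there is no next column, but the missing term is a multiple of U_0 = 0. *)
rewrite big1 => [|l _]; last by rewrite ltn_eqF ?mulr0 //; apply: leq_trans j1.
by rewrite (_ : (d - 1 - j = 0)%N) //; lia.
Qed.

(** Removing the primed letter from the symplectic formula; the sum over vertical strips extends to
    a product of intervals because the added terms vanish. *)
Let spo_shape la : decr la -> (forall i : 'I_d, nth 0%N lam i = la i) ->
  den d * spo d 1 lam x y = dt d (fun i j => zcheb z (rowlen la j + (d - 1 - j)) (t i)).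
Proof.
move=> dla lamE; have ad : (2 * d < 2 * d + 1)%N by lia.
rewrite (osp_tab _ _ dla lamE) addn1 (tab_sum_step x y (Ordinal ad) dla) /= big_distrr /=.
have -> : letter_weight d x y (2 * d) = z by rewrite /letter_weight ltnn.
rewrite -dt_primed // -(@dt_rows d _ _ (fun i j b => z ^+ (rowlen la j - b) * cheb (t i) (b + (d - j)))) //; last first.
  by move=> j; apply: rowlen_le.
rewrite [RHS](bigID (fun nu : shape => [forall i : 'I_d, rowlen nu i.+1 <= nu i]%N)) /=.
(* If [nu] increases from row [i] to row [i.+1], the intervals force the increase to be exactly 1,
   and two adjacent columns coincide. *)
rewrite [X in _ = _ + X]big1 ?addr0; last first.
  move=> nu /andP[/familyP h /forallPn[i]]; rewrite -ltnNge => lt.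
  have h1 (l : 'I_d) : ((la l).-1 <= nu l <= la l)%N.
    by have := h l; rewrite unfold_in /rows_in ltn_ord !rowlen_ord.
  have id : (i.+1 < d)%N by rewrite ltnNge; apply/negP => /(rowlen_ge nu) e; rewrite e in lt.
  pose i1 := Ordinal id.
  have e1 : rowlen nu i.+1 = nu i1 by rewrite -rowlen_ord.
  have e2 := dla i i1 (ltnSn _).
  rewrite (dt_scalec _ (fun j => z ^+ (rowlen la j - rowlen nu j)) (fun i j => cheb (t i) (rowlen nu j + (d - j)))).
  rewrite (@dt_col_eq0 _ _ _ i i.+1) ?mulr0 ?ltnSn //= => l _.
  congr cheb; rewrite rowlen_ord e1.
  by move: lt (h1 i) (h1 i1) e2; rewrite e1 => *; lia.
apply: eq_big => [nu|nu str]; first exact: strip_vertical.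
have [s1 dnu _ _ _] := stripP _ _ _ str.
rewrite mulrCA (Weyl_all (leqnn d)) //; last by move=> i; rewrite leqNgt ltn_ord.
rewrite (dt_scalec _ (fun j => z ^+ (rowlen la j - rowlen nu j)) (fun i j => cheb (t i) (rowlen nu j + (d - j)))).
rewrite prodrXr -sumnB //; congr (_ ^+ _ * _).
by apply: eq_bigr => i _; rewrite !rowlen_ord.
Qed.

Lemma nth_ncols j : (nth 0%N lam j <= C)%N.
Proof.
rewrite /ncols; elim: lam j => [|a s IH] [|j] //=; first exact: leq_maxl.
exact: leq_trans (IH j) (leq_maxr _ _).
Qed.

Lemma spo_det : (forall j j', (j <= j')%N -> (nth 0%N lam j' <= nth 0%N lam j)%N) ->
  dt d (fun i j => cheb (x i + (x i)^-1) (d - j)) * spo d 1 lam x (fun=> z) =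
  dt d (fun i j => zcheb z (nth 0%N lam j + (d - 1 - j)) (x i + (x i)^-1)).
Proof.
move=> dlam; pose la : shape := [ffun i : 'I_d => inord (nth 0%N lam i)].
have laE (i : 'I_d) : la i = nth 0%N lam i :> nat by rewrite ffunE inordK // ltnS nth_ncols.
rewrite (@spo_shape la) //; last by move=> i i' /ltnW ii; rewrite !laE dlam.
apply: dt_ext => i j id jd; congr (zcheb _ (_ + _) _).
by rewrite -[j]/(val (Ordinal jd)) rowlen_ord laE.
Qed.

End Branching.
End Shapes.

(** * The identity *)

Section Final.
Variable F : fieldType.

(** Both sides satisfy the same three-term recurrence in [a], hence the induction on pairs of
    consecutive values. *)
Lemma cheb_pow (w : F) a : w != 0 ->
  w ^+ a - w^-1 ^+ a = (w - w^-1) * cheb (w + w^-1) a.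
Proof.
move=> w0; have ww : w * w^-1 = 1 by rewrite divff.
have [] : (w ^+ a - w^-1 ^+ a = (w - w^-1) * cheb (w + w^-1) a) /\
  (w ^+ a.+1 - w^-1 ^+ a.+1 = (w - w^-1) * cheb (w + w^-1) a.+1); last by [].
elim: a => [|a [IH1 IH2]]; first by rewrite /cheb !expr0 !expr1 subrr mulr0 mulr1.
split=> //; rewrite chebSS mulrBr mulrCA -IH2 -IH1 !exprS.
move: (w^-1) ww => v ww; apply/eqP; rewrite -subr_eq0; apply/eqP.
transitivity ((w ^+ a - v ^+ a) * (1 - w * v)); first by ring.
by rewrite ww subrr mulr0.
Qed.

(* Border the k x (k+1) matrix c by the row of powers of -z; column operations clear
   that row but for its last entry, while expanding along it gives the sum. *)
Lemma dt_shift_sum k (z : F) (c : nat -> nat -> F) :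
  dt k (fun i j => c i j + z * c i j.+1) =
  \sum_(l < k.+1) z ^+ (k - l) * dt k (fun i j => c i (bump l j)).
Proof.
pose M i j := if (i < k)%N then c i j else (- z) ^+ (k - j).
pose U (l j : nat) : F := (l == j)%:R + z * (l == j.+1)%:R.
have dU : dt k.+1 U = 1.
  apply: dt_trig1 => [i j /andP[ij jd]|i id]; rewrite /U.
    by rewrite (ltn_eqF ij) (ltn_eqF (ltnW ij : i < j.+1)%N) mulr0 addr0.
  by rewrite eqxx (ltn_eqF (ltnSn i)) mulr0 addr0.
have E (f : nat -> F) j : (j < k)%N -> \sum_(l < k.+1) f l * U l j = f j + z * f j.+1.
  move=> jk; rewrite (eq_bigr (fun l : 'I_k.+1 => f l * (l == j :> nat)%:R + z * (f l * (l == j.+1 :> nat)%:R))).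
    by rewrite big_split /= -big_distrr /= !sum_delta_r // ltnW.
  by move=> l _; rewrite /U; ring.
transitivity (dt k.+1 M).
  rewrite -[RHS]mulr1 -[X in _ = _ * X]dU -dt_mul -addn1 [RHS]dt_ublock => [|i j i1 jk]; last first.
    have i0 : i = 0%N by lia.
    rewrite addn1 (E (M (k + i)%N)) // /M i0 addn0 ltnn.
    by rewrite (_ : k - j = (k - j.+1).+1)%N ?exprS; [ring | lia].
  rewrite [X in _ * X](_ : _ = 1) ?mulr1.
    by apply: dt_ext => i j ik jk; rewrite addn1 (E (M i)) // /M ik.
  rewrite /dt det_mx11 mxE addn1 !addn0 (eq_bigr (fun l : 'I_k.+1 => M k l * (l == k :> nat)%:R)).
    by rewrite (sum_delta_r (M k)) // /M ltnn subnn expr0.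
  by move=> l _; rewrite /U (ltn_eqF (ltn_ord l)) mulr0 addr0.
rewrite /dt (expand_det_row _ ord_max); apply: eq_bigr => l _.
have lk : (l <= k)%N by rewrite -ltnS.
(* The cofactor sign turns the power of [- z] into a power of [z]. *)
rewrite mxE /= /M ltnn /cofactor /= (exprNn z) mulrACA -exprD.
rewrite (_ : (k - l + (k + l) = 2 * k)%N); last lia.
rewrite exprM sqrrN expr1n expr1n mul1r; congr (_ * \det _).
apply/matrixP => i j; have ik : (i < k)%N := ltn_ord i.
have bi : bump k i = i by rewrite /bump leqNgt ik.
by rewrite !mxE /= bi ik.
Qed.

(** The integer exponents are given as naturals [e j]: an entry [-1] of [mu], which arises for
    [r = 0], is compensated by [N - j], at least 1. *)
Lemma sp_num_cheb N (mu : seq int) (e : nat -> nat) (w : nat -> F) :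
  (forall i, (i < N)%N -> w i != 0) ->
  (forall j, (j < N)%N -> nth 0 mu j + (N - j)%:Z = (e j)%:Z) ->
  sp_num N mu w = (\prod_(i < N) (w i - (w i)^-1)) * dt N (fun i j => cheb (w i + (w i)^-1) (e j)).
Proof.
move=> w0 eE; rewrite -(dt_scaler _ (fun i => w i - (w i)^-1)); congr (\det _); apply/matrixP => i j.
by rewrite !mxE eE // -!exprnP cheb_pow // w0.
Qed.

Lemma sp_den_cheb N (w : nat -> F) :
  (forall i, (i < N)%N -> w i != 0) ->
  sp_den N w = (\prod_(i < N) (w i - (w i)^-1)) * dt N (fun i j => cheb (w i + (w i)^-1) (N - j)).
Proof.
move=> w0; rewrite -(dt_scaler _ (fun i => w i - (w i)^-1)); congr (\det _); apply/matrixP => i j.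
by rewrite !mxE cheb_pow // w0.
Qed.

Lemma sum_dt_product n k r (u v : nat -> F) (z : F) :
  (\prod_(i < n) \prod_(j < k + n) (u i - v j)) *
  (\sum_(f : {ffun 'I_n -> 'I_r.+1} | is_bounded_part f)
    dt n (fun i j => zcheb z (nth 0%N (part_seq f) j + (n - 1 - j)) (u i)) *
    dt (k + n) (fun i j => zcheb z (nth 0%N (nseq k r ++ part_seq f) j + (k + n - 1 - j)) (v i))) =
  dt (n + (k + n)) (fun i j => zcheb z (r + n + (k + n) - 1 - j) (catvars n u v i)).
Proof. by rewrite -sum_bounded_part dt_cat_kernel. Qed.

(** The case [z = 0], [r = 0] of the preceding identity: only the empty partition occurs, and p_a
    becomes U_(a+1). *)
Lemma cheb_den_cat n k (u v : nat -> F) :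
  dt (n + (k + n)) (fun i j => cheb (catvars n u v i) (n + (k + n) - j)) =
  (\prod_(i < n) \prod_(j < k + n) (u i - v j)) *
  (dt n (fun i j => cheb (u i) (n - j)) * dt (k + n) (fun i j => cheb (v i) (k + n - j))).
Proof.
have q0 t a : zcheb 0 a t = cheb t a.+1 :> F by rewrite /zcheb mul0r addr0.
transitivity (dt (n + (k + n)) (fun i j => zcheb 0 (0 + n + (k + n) - 1 - j) (catvars n u v i))).
  by apply: dt_ext => i j iN jN; rewrite q0; congr cheb; lia.
rewrite -sum_dt_product; congr (_ * _).
rewrite (big_pred1 [ffun=> ord0]) => [|f]; last first.
  rewrite /= (_ : f = [ffun=> ord0]) ?eqxx.
    by apply/forallP => i; apply/forallP => j; rewrite !ffunE implybT.
  by apply/ffunP => i; rewrite ffunE ord1.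
have p0 j : nth 0%N (part_seq ([ffun=> ord0] : {ffun 'I_n -> 'I_1})) j = 0%N.
  case: (ltnP j n) => h; first by rewrite (nth_part_seq _ h) ffunE.
  by rewrite nth_default // size_map size_enum_ord.
congr (_ * _); apply: dt_ext => i j iN jN; rewrite q0.
  by rewrite p0; congr cheb; lia.
rewrite -/(rpart k _ j); have -> : rpart k ([ffun=> ord0] : {ffun 'I_n -> 'I_1}) j = 0%N.
  by have := rpart_le k ([ffun=> ord0] : {ffun 'I_n -> 'I_1}) j; lia.
by congr cheb; lia.
Qed.

End Final.

Theorem theorem4p6 (F : fieldType) (m n r : nat) (x y : nat -> F) (z : F) :
  (0 < n)%N -> (n <= m)%N ->
  (forall i, (i < n)%N -> x i != 0) ->
  (forall j, (j < m)%N -> y j != 0) ->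
  sp_den (m + n) (catvars n x y) != 0 ->
  \sum_(f : {ffun 'I_n -> 'I_r.+1} | is_bounded_part f)
     z ^+ r * spo n 1 (part_seq f) x (fun _ => z)
           * spo m 1 (nseq (m - n) r ++ part_seq f) y (fun _ => z)
  = \sum_(1 <= j < (m + n + 2)%N)
      z ^+ (r + m + n + 1 - j)
        * sp (m + n) (nseq (j - 1) (r%:Z) ++ nseq (m + n + 1 - j) (r%:Z - 1))
             (catvars n x y).
Proof.
move=> n0 nm xn0 yn0 den0.
move: nm yn0 den0 => /subnK <-; rewrite addnK; move: (m - n)%N => {m} k yn0 den0.
set N := (k + n + n)%N.
pose u i := x i + (x i)^-1; pose v i := y i + (y i)^-1.
set w := catvars n x y.
have w0 i : (i < N)%N -> w i != 0.
  by rewrite /w /catvars => iN; case: ltnP => h; [exact: xn0 | apply: yn0; lia].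
have wt i : w i + (w i)^-1 = catvars n u v i by rewrite /w /catvars; case: ifP.
pose Vn := dt n (fun i j => cheb (u i) (n - j)).
pose Vm := dt (k + n) (fun i j => cheb (v i) (k + n - j)).
pose Q := \prod_(i < n) \prod_(j < k + n) (u i - v j).
pose P := \prod_(i < N) (w i - (w i)^-1).
have den_eq : sp_den N w = P * (Q * (Vn * Vm)).
  rewrite sp_den_cheb // -cheb_den_cat addnC; congr (_ * _).
  by apply: dt_ext => i j _ _; rewrite wt.
(* A nonzero symplectic denominator makes all its factors nonzero, which allows clearing
   denominators on both sides. *)
move: den0; rewrite den_eq !mulf_eq0 !negb_or => /and4P[P0 Q0 Vn0 Vm0].
have size_part (f : {ffun 'I_n -> 'I_r.+1}) : size (part_seq f) = n by rewrite size_map size_enum_ord.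
apply: (mulfI Q0); apply: (mulfI Vm0); apply: (mulfI Vn0).
(* Both sides are compared with [z ^+ r] times the bialternant of the p_a, each written out as
   U_(a+1) + z U_a. *)
transitivity (z ^+ r * dt N (fun i j => cheb (catvars n u v i) (r + N - j) + z * cheb (catvars n u v i) (r + N - j.+1))).
  have -> : dt N (fun i j => cheb (catvars n u v i) (r + N - j) + z * cheb (catvars n u v i) (r + N - j.+1)) =
     dt (n + (k + n)) (fun i j => zcheb z (r + n + (k + n) - 1 - j) (catvars n u v i)).
    rewrite /N addnC; apply: dt_ext => i j iN jN; rewrite /zcheb.
    by congr (cheb _ _ + _ * cheb _ _); lia.
  rewrite -sum_dt_product -/Q !big_distrr /=; apply: eq_bigr => f fp.
  have /= S1 := @spo_det F (part_seq f) x z.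
  have /= S2 := @spo_det F (nseq k r ++ part_seq f) y z.
  rewrite size_part in S1; rewrite size_cat size_nseq size_part in S2.
  rewrite -S1 -?S2 //; last first.
  (* With no copies of [r] in front, [rpart] is the partition itself. *)
  - by move=> i j ij; have := @rpart_dec n 0 r f i j fp ij.
  - by move=> i j ij; have := @rpart_dec n k r f i j fp ij.
  rewrite -/Vn -/Vm; ring.
rewrite dt_shift_sum big_add1 addn2 /= big_mkord !big_distrr /=; apply: eq_bigr => l _.
have lN : (l <= N)%N by rewrite -ltnS.
(* Skipping the index [l] with [bump] lowers the exponents from column [l] on by one: [l] entries
   [r], then entries [r - 1], so [l = j - 1]. *)
rewrite /sp den_eq (@sp_num_cheb F N _ (fun j => r + N - bump l j)%N w w0); last first.
  move=> j jN; rewrite nth_cat size_nseq subn1 /= !nth_nseq /bump.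
  case: (ltnP j l) => jl; first by rewrite add0n; lia.
  by rewrite ifT; lia.
have -> : dt N (fun i j => cheb (w i + (w i)^-1) (r + N - bump l j)) =
  dt N (fun i j => cheb (catvars n u v i) (r + N - bump l j)).
  by apply: dt_ext => i j _ _; rewrite wt.
rewrite -/P mulrA -exprD (_ : (r + (N - l) = r + (k + n) + n + 1 - l.+1)%N); last by move: lN; rewrite /N; lia.
by field; rewrite P0 Q0 Vn0 Vm0.
Qed.
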